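(* Let $$M(Z)=\begin{cases}a_{11}Z+a_{12}& \text{for }Z<0,\\ a_{21}Z+a_{22}&\text{for }Z>0,\end{cases}$$ be any piecewise affine map with real coefficients and $a_{11},a_{21}>0$. Then, there exists a slow-fast system of the form $$x' = y-F(x,z,\epsilon,\delta),\qquad y'=\epsilon g_1(x,y,z,\epsilon,\delta),\qquad z'=\epsilon g_2(x,y,z,\epsilon,\delta)$$ which satisfies Assumptions 1 through 5 stated in the context and such that the piecewise affine map (PAM) associated to this vector field, as defined in the context, is given by $M$.
   Context: **Setting.** $F,g_1,g_2$ are $C^\infty$-smooth in their arguments; $x\in\mathbb{R}$ is the fast variable and $(y,z)\in\mathbb{R}^2$ are the slow variables; $\epsilon\ge 0$ is a small singular perturbation parameter and $\delta$ is an additional small parameter. Put $f(x,y,z,\epsilon,\delta):=y-F(x,z,\epsilon,\delta)$. The layer problem is $x'=y-F(x,z,0,\delta)$, $y'=0$, $z'=0$; the reduced problem is $0=y-F(x,z,0,\delta)$, $\dot y=g_1(x,y,z,0,\delta)$, $\dot z=g_2(x,y,z,0,\delta)$ (with slow time $\tau=\epsilon t$). The critical manifold is $\mathcal S=\{f(x,y,z,0,\delta)=0\}$. **Assumption 1.** Possibly restricting to a part of phase space with $z\in(z_{\min},z_{\max})$, one has $\mathcal S=\mathcal S_{a_1}\cup L_1\cup\mathcal S_{r_1}\cup L_2\cup\mathcal S_{a_2}\cup L_3\cup\mathcal S_{r_2}\cup L_4\cup\mathcal S_{a_3}$, where $\mathcal S_{a_1}\cup\mathcal S_{a_2}\cup\mathcal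 S_{a_3}=\mathcal S\cap\{\partial f/\partial x<0\}$ (normally attracting) and $\mathcal S_{r_1}\cup\mathcal S_{r_2}=\mathcal S\cap\{\partial f/\partial x>0\}$ (normally repelling) at $\epsilon=0$. The fold curves $L_i$ ($i=1,2,3,4$) are graphs over $z$: $L_i=\{(x,y,z)\in\mathcal S: x=\nu_i(z,\delta)\}$ with $\nu_1<\nu_2<\nu_3<\nu_4$, along which $\partial f/\partial x=0$ and $\partial^2 f/\partial x^2\ne 0$ at $\epsilon=0$. On $\mathcal S$: $\mathcal S_{a_1}=\{x<\nu_1\}$, $\mathcal S_{r_1}=\{\nu_1<x<\nu_2\}$, $\mathcal S_{a_2}=\{\nu_2<x<\nu_3\}$, $\mathcal S_{r_2}=\{\nu_3<x<\nu_4\}$, $\mathcal S_{a_3}=\{x>\nu_4\}$. **Assumption 2 (normal switching condition).** $f_yg_1+f_zg_2\neq0$ at every $p\in L_i$, $i=1,2,3,4$ (every fold point is a jump point), and the reduced flow on both sides of $L_i$ ($i=1,3,4$) is transverse to, and directed towards, $L_i$. **Assumption 3 (transversality).** Let $\omega(L_2)$ be the projection (along the layer flow) of $L_2$ onto $\mathcal S_{a_1}$, $\omega(L_1)$ and $\omega(L_3)$ the projections of $L_1$ and $L_3$ onto $\mathcal S_{a_3}$, and $\omega(L_4)$ the projection of $L_4$ onto both $\mathcal S_{a_1}$ and $\mathcal S_{a_2}$. For $\delta=0$, the reduced flow is transverse to $\omega(L_1)$ and $\omega(L_3)$ on $\mathcal S_{a_3}$, to $\omega(L_2)$ on $\mathcal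 S_{a_1}$, and to $\omega(L_4)$ on both $\mathcal S_{a_1}$ and $\mathcal S_{a_2}$. **Section $\Delta$.** $\Delta$ is a section between $L_2$ and $L_4$, transverse to the layer flow and with coordinates $(y,z)$; it is crossed by the fast orbits leaving $L_4$. $P(L_2),P(L_4)$ denote the projections (along the layer flow) of $L_2,L_4$ onto $\Delta$. **Assumption 4 (breaking mechanism).** For $\epsilon=0$ and $\delta>0$ sufficiently small, the $z$-parametrized curves $P(L_2)$ and $P(L_4)$ intersect transversely at a $z$-value $z_0(\delta)$, with $z_0(0)=z_0$ and $z_0'(0)=0$; the ($\delta$-dependent) intersection point is $P_c$. For $z<z_0(\delta)$, the forward evolution of $P(L_4)$ remains below $\mathcal S_{r_1}$ and $\mathcal S_{a_2}$ and lands directly on $\mathcal S_{a_1}$; for $z>z_0(\delta)$, it lands on $\mathcal S_{a_2}$, away from $L_2$. **Assumption 5 (ambiguous singular orbit).** (For $\delta=0$) there is a singular closed orbit $\Gamma_0^L$ obtained by concatenating the reduced flow on $\mathcal S_{a_1}$ and $\mathcal S_{a_3}$ with the layer flow from $L_1$ to $\mathcal S_{a_3}$ and from $L_4$ to $\mathcal S_{a_1}$; and a singular closed orbit $\Gamma_0^S$ obtained by concatenating the reduced flow on $\mathcal S_{a_2}$ and $\mathcal S_{a_3}$ with the layer flow from $L_3$ to $\mathcal S_{a_3}$ and from $L_4$ to $\mathcal S_{a_2}$. Both contain $P_c$. **Standing convention.** $\Gamma_0^L$ and $\Gamma_0^S$ lie in the plane $z=z_0$, and $g_2(x,y,z,\epsilon,\delta)=\delta\,G(x,y,z,\epsilon,\delta)+(z-z_0)H(x,y,z,\epsilon,\delta)$.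 **Associated PAM.** For a curve $\gamma$ (oriented by the reduced flow) on a normally hyperbolic segment of $\mathcal S$, parametrized by $x$, define $$M_\gamma(Z)=\Big(e^{\int_\gamma p(x)\,dx}\Big)Z+\int_\gamma q(x)\,e^{\int_{\gamma_x}p(x')\,dx'}\,dx,$$ $$p(x)=\frac{H(x,y,z,0,0)}{g_1(x,y,z,0,0)}F_x(x,z),\qquad q(x)=\frac{G(x,y,z,0,0)}{g_1(x,y,z,0,0)}F_x(x,z),$$ with $F(x,z):=F(x,z,0,0)$, where $y,z$ are the coordinates along $\gamma$ (so $y=F(x,z)$) and $\gamma_x$ is the part of $\gamma$ from $x$ to its end. The PAM associated with the system is $$Z\mapsto\begin{cases}M_{\Gamma_0^L\cap\mathcal S_{a_3}}\circ M_{\Gamma_0^L\cap\mathcal S_{a_1}}(Z),& Z<0,\\ M_{\Gamma_0^S\cap\mathcal S_{a_3}}\circ M_{\Gamma_0^S\cap\mathcal S_{a_2}}(Z),& Z>0.\end{cases}$$ *)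

(* Defs.v *)
From Stdlib Require Import Reals.
From Coquelicot Require Import Coquelicot.
Open Scope R_scope.

(** * Smoothness *)

(* [U] is meant to be open; in finite dimension, "all directional derivatives
   are C^k" is the usual C^(k+1). *)
Fixpoint Ck_on {V : NormedModule R_AbsRing} (U : V -> Prop) (k : nat)
    (h : V -> R) : Prop :=
  match k with
  | O => forall p, U p -> continuous h p
  | S k' => exists Dh : V -> V -> R,
      (forall p, U p -> filterdiff h (locally p) (Dh p)) /\
      (forall v, Ck_on U k' (fun p => Dh p v))
  end.

Definition smooth_on {V : NormedModule R_AbsRing} (U : V -> Prop)
    (h : V -> R) : Prop := forall k, Ck_on U k h.

Definition smooth2_on (U : R -> R -> Prop) (h : R -> R -> R) : Prop :=
  smooth_on (fun p : R * R => let '(a, b) := p in U a b)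
            (fun p : R * R => let '(a, b) := p in h a b).

Definition smooth4 (h : R -> R -> R -> R -> R) : Prop :=
  smooth_on (fun _ => True)
    (fun p : R * R * R * R => let '(a, b, c, d) := p in h a b c d).

Definition smooth5 (h : R -> R -> R -> R -> R -> R) : Prop :=
  smooth_on (fun _ => True)
    (fun p : R * R * R * R * R => let '(a, b, c, d, e) := p in h a b c d e).

(** * The slow-fast system

    x' = y - F(x,z,eps,delta),  y' = eps g1(x,y,z,eps,delta),
    z' = eps g2(x,y,z,eps,delta). *)

Record slow_fast := SlowFast {
  F : R -> R -> R -> R -> R;
  g1 : R -> R -> R -> R -> R -> R;
  g2 : R -> R -> R -> R -> R -> R
}.

Definition smooth_system (s : slow_fast) : Prop :=
  smooth4 (F s) /\ smooth5 (g1 s) /\ smooth5 (g2 s).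

Definition f (s : slow_fast) (x y z eps delta : R) : R := y - F s x z eps delta.

(* Partial derivatives of [f] at eps = 0. *)
Definition f_x (s : slow_fast) (delta x y z : R) : R :=
  Derive (fun u => f s u y z 0 delta) x.
Definition f_xx (s : slow_fast) (delta x y z : R) : R :=
  Derive_n (fun u => f s u y z 0 delta) 2 x.
Definition f_y (s : slow_fast) (delta x y z : R) : R :=
  Derive (fun u => f s x u z 0 delta) y.
Definition f_z (s : slow_fast) (delta x y z : R) : R :=
  Derive (fun u => f s x y u 0 delta) z.

(* f_y g1 + f_z g2 at eps = 0. *)
Definition switching (s : slow_fast) (delta x y z : R) : R :=
  f_y s delta x y z * g1 s x y z 0 delta + f_z s delta x y z * g2 s x y z 0 delta.

(* x-component of the reduced vector field: differentiating f = 0 along the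
   reduced flow gives f_x * xdot + f_y * g1 + f_z * g2 = 0. *)
Definition reduced_xdot (s : slow_fast) (delta x y z : R) : R :=
  - switching s delta x y z / f_x s delta x y z.

(** * Geometric data *)

Inductive fold := L1 | L2 | L3 | L4.
Inductive sheet := Sa1 | Sr1 | Sa2 | Sr2 | Sa3.

(* The section Delta is the surface x = [secx] y z over the (y,z)-domain [secD];
   [z0] delta is the z-value at which P(L2) and P(L4) cross. *)
Record geometry := Geometry {
  zmin : R;
  zmax : R;
  delta0 : R;
  nu : fold -> R -> R -> R;
  secD : R -> R -> Prop;
  secx : R -> R -> R;
  z0 : R -> R
}.

Definition small (G : geometry) (delta : R) : Prop := Rabs delta < delta0 G.
Definition in_range (G : geometry) (z : R) : Prop := zmin G < z < zmax G.

(* Subsets of (x,y,z)-space. *)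
Definition region := R -> R -> R -> Prop.

Definition critical (s : slow_fast) (G : geometry) (delta : R) : region :=
  fun x y z => in_range G z /\ f s x y z 0 delta = 0.

Definition on_fold (s : slow_fast) (G : geometry) (delta : R) (i : fold) : region :=
  fun x y z => critical s G delta x y z /\ x = nu G i z delta.

Definition on_sheet (s : slow_fast) (G : geometry) (delta : R) (j : sheet) : region :=
  fun x y z => critical s G delta x y z /\
    match j with
    | Sa1 => x < nu G L1 z delta
    | Sr1 => nu G L1 z delta < x < nu G L2 z delta
    | Sa2 => nu G L2 z delta < x < nu G L3 z delta
    | Sr2 => nu G L3 z delta < x < nu G L4 z delta
    | Sa3 => nu G L4 z delta < x
    end.

(* y-coordinate of the point of L_i with given z. *)
Definition fold_y (s : slow_fast) (G : geometry) (delta : R) (i : fold) (z : R) : R :=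
  F s (nu G i z delta) z 0 delta.

Definition fold_pt (s : slow_fast) (G : geometry) (delta : R) (i : fold) (z : R)
  : R * R * R := (nu G i z delta, fold_y s G delta i z, z).

(** * Layer flow and reduced flow *)

Definition layer_ode_at (s : slow_fast) (delta y z : R) (phi : R -> R) (t : R) : Prop :=
  is_derive phi t (f s (phi t) y z 0 delta).

Definition layer_connection (s : slow_fast) (delta y z xa xb : R) (phi : R -> R) : Prop :=
  (forall t, layer_ode_at s delta y z phi t) /\
  is_lim phi m_infty xa /\ is_lim phi p_infty xb.

(* Finite concatenations of layer connections with the same (y,z): at the
   z-value where L4 connects to L2, the layer flow from L4 reaches S_a1 by
   passing through L2. *)
Inductive layer_path (s : slow_fast) (delta y z : R) : R -> R -> Prop :=
| layer_path_one : forall xa xb phi,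
    layer_connection s delta y z xa xb phi -> layer_path s delta y z xa xb
| layer_path_cat : forall xa xm xb,
    layer_path s delta y z xa xm -> layer_path s delta y z xm xb ->
    layer_path s delta y z xa xb.

(* omega(L_i): the projection of L_i along the layer flow. *)
Definition omega (s : slow_fast) (G : geometry) (delta : R) (i : fold) : region :=
  fun x y z => in_range G z /\ y = fold_y s G delta i z /\
    layer_path s delta y z (nu G i z delta) x.

Definition transverse2 (u v : R * R) : Prop :=
  fst u * snd v - snd u * fst v <> 0.

(* At a point of a normally hyperbolic sheet, (y,z) are coordinates on the
   sheet, in which the reduced vector field is (g1,g2); since the layer flow
   preserves (y,z), the curve omega(L_i) is z |-> (fold_y z, z). *)
Definition reduced_transverse_to_omega (s : slow_fast) (G : geometry) (delta : R)
    (i : fold) (j : sheet) : Prop :=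
  forall x y z, omega s G delta i x y z -> on_sheet s G delta j x y z ->
    ex_derive (fold_y s G delta i) z /\
    transverse2 (g1 s x y z 0 delta, g2 s x y z 0 delta)
                (Derive (fold_y s G delta i) z, 1).

Definition layer_arc (s : slow_fast) (delta : R) (p q : R * R * R) (C : region) : Prop :=
  let '(xp, yp, zp) := p in
  let '(xq, yq, zq) := q in
  yp = yq /\ zp = zq /\
  exists phi, layer_connection s delta yp zp xp xq phi /\
    forall x y z, C x y z <-> (exists t, x = phi t) /\ y = yp /\ z = zp.

(* A reduced trajectory on sheet [j] from [p] to [q]; the endpoints may be fold
   points, where the reduced x-velocity is unbounded, so the equations are only
   imposed on the open time interval. *)
Definition reduced_arc (s : slow_fast) (G : geometry) (delta : R) (j : sheet)
    (p q : R * R * R) (C : region) : Prop :=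
  exists (T : R) (X Y Z : R -> R),
    0 < T /\
    (forall tau, 0 <= tau <= T ->
       continuous X tau /\ continuous Y tau /\ continuous Z tau) /\
    (forall tau, 0 < tau < T ->
       on_sheet s G delta j (X tau) (Y tau) (Z tau) /\
       is_derive Y tau (g1 s (X tau) (Y tau) (Z tau) 0 delta) /\
       is_derive Z tau (g2 s (X tau) (Y tau) (Z tau) 0 delta)) /\
    (X 0, Y 0, Z 0) = p /\ (X T, Y T, Z T) = q /\
    forall x y z, C x y z <->
      exists tau, 0 <= tau <= T /\ x = X tau /\ y = Y tau /\ z = Z tau.

(** * The assumptions *)

Definition assumption1 (s : slow_fast) (G : geometry) : Prop :=
  zmin G < zmax G /\ 0 < delta0 G /\
  (forall i, smooth2_on (fun z delta => in_range G z /\ small G delta) (nu G i)) /\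
  forall delta, small G delta ->
    (forall z, in_range G z ->
       nu G L1 z delta < nu G L2 z delta /\
       nu G L2 z delta < nu G L3 z delta /\
       nu G L3 z delta < nu G L4 z delta) /\
    (forall x y z, critical s G delta x y z <->
       (exists j, on_sheet s G delta j x y z) \/
       (exists i, on_fold s G delta i x y z)) /\
    (forall x y z,
       (on_sheet s G delta Sa1 x y z \/ on_sheet s G delta Sa2 x y z \/
        on_sheet s G delta Sa3 x y z) <->
       (critical s G delta x y z /\ f_x s delta x y z < 0)) /\
    (forall x y z,
       (on_sheet s G delta Sr1 x y z \/ on_sheet s G delta Sr2 x y z) <->
       (critical s G delta x y z /\ 0 < f_x s delta x y z)) /\
    (forall i x y z, on_fold s G delta i x y z ->
       f_x s delta x y z = 0 /\ f_xx s delta x y z <> 0).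

(* The reduced flow near L_i moves strictly towards L_i on both sides: x - nu_i(z)
   has nonzero derivative along it, of sign opposite to its own. *)
Definition directed_towards_fold (s : slow_fast) (G : geometry) (delta : R)
    (i : fold) : Prop :=
  forall zf, in_range G zf ->
    exists eta, 0 < eta /\
      forall x y z, critical s G delta x y z ->
        Rabs (z - zf) < eta -> Rabs (x - nu G i zf delta) < eta ->
        x <> nu G i z delta ->
        (x - nu G i z delta) *
        (reduced_xdot s delta x y z
         - Derive (fun w => nu G i w delta) z * g2 s x y z 0 delta) < 0.

Definition assumption2 (s : slow_fast) (G : geometry) : Prop :=
  forall delta, small G delta ->
    (forall i x y z, on_fold s G delta i x y z -> switching s delta x y z <> 0) /\
    directed_towards_fold s G delta L1 /\
    directed_towards_fold s G delta L3 /\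
    directed_towards_fold s G delta L4.

Definition projects_onto (s : slow_fast) (G : geometry) (delta : R)
    (i : fold) (j : sheet) (z : R) : Prop :=
  exists x y, omega s G delta i x y z /\ on_sheet s G delta j x y z.

Definition assumption3 (s : slow_fast) (G : geometry) : Prop :=
  (forall z, in_range G z ->
     projects_onto s G 0 L1 Sa3 z /\ projects_onto s G 0 L3 Sa3 z /\
     projects_onto s G 0 L2 Sa1 z /\
     (projects_onto s G 0 L4 Sa1 z \/ projects_onto s G 0 L4 Sa2 z)) /\
  (exists z, projects_onto s G 0 L4 Sa1 z) /\
  (exists z, projects_onto s G 0 L4 Sa2 z) /\
  reduced_transverse_to_omega s G 0 L1 Sa3 /\
  reduced_transverse_to_omega s G 0 L3 Sa3 /\
  reduced_transverse_to_omega s G 0 L2 Sa1 /\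
  reduced_transverse_to_omega s G 0 L4 Sa1 /\
  reduced_transverse_to_omega s G 0 L4 Sa2.

(* P(L2) and P(L4) in the coordinates (y,z) of Delta: L2 is reached in forward
   time from Delta, and L4 in backward time. *)
Definition PL2 (s : slow_fast) (G : geometry) (delta y z : R) : Prop :=
  secD G y z /\ y = fold_y s G delta L2 z /\
  exists phi, phi 0 = secx G y z /\
    (forall t, 0 <= t -> layer_ode_at s delta y z phi t) /\
    is_lim phi p_infty (nu G L2 z delta).

Definition PL4 (s : slow_fast) (G : geometry) (delta y z : R) : Prop :=
  secD G y z /\ y = fold_y s G delta L4 z /\
  exists phi, phi 0 = secx G y z /\
    (forall t, t <= 0 -> layer_ode_at s delta y z phi t) /\
    is_lim phi m_infty (nu G L4 z delta).

(* The layer vector field (f,0,0) is transverse to the graph x = secx y z exactly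
   where f does not vanish. *)
Definition section_ok (s : slow_fast) (G : geometry) : Prop :=
  open (fun p : R * R => let '(y, z) := p in secD G y z) /\
  smooth2_on (secD G) (secx G) /\
  (forall y z, secD G y z -> in_range G z) /\
  forall delta, small G delta ->
    (forall y z, secD G y z ->
       nu G L2 z delta < secx G y z < nu G L4 z delta /\
       f s (secx G y z) y z 0 delta <> 0) /\
    (forall z, in_range G z -> exists y, PL4 s G delta y z).

(* The forward layer orbit of the point of Delta over (y,z) lands on sheet [j]. *)
Definition lands_on (s : slow_fast) (G : geometry) (delta : R) (j : sheet)
    (y z : R) : Prop :=
  exists phi x, phi 0 = secx G y z /\
    (forall t, 0 <= t -> layer_ode_at s delta y z phi t) /\
    is_lim phi p_infty x /\ on_sheet s G delta j x y z.

Definition assumption4 (s : slow_fast) (G : geometry) : Prop :=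
  is_derive (z0 G) 0 0 /\
  forall delta, 0 <= delta < delta0 G ->
    in_range G (z0 G delta) /\
    (exists c2 c4 : R -> R,
       (forall y z, PL2 s G delta y z <-> in_range G z /\ y = c2 z) /\
       (forall y z, PL4 s G delta y z <-> in_range G z /\ y = c4 z) /\
       c2 (z0 G delta) = c4 (z0 G delta) /\
       ex_derive c2 (z0 G delta) /\ ex_derive c4 (z0 G delta) /\
       transverse2 (Derive c2 (z0 G delta), 1) (Derive c4 (z0 G delta), 1)) /\
    (forall y z, PL4 s G delta y z -> z < z0 G delta ->
       (forall x yS, on_sheet s G delta Sr1 x yS z \/ on_sheet s G delta Sa2 x yS z ->
          y < yS) /\
       lands_on s G delta Sa1 y z) /\
    (forall y z, PL4 s G delta y z -> z0 G delta < z ->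
       lands_on s G delta Sa2 y z).

(* The intersection point P_c of P(L2) and P(L4), for delta = 0. *)
Definition is_Pc (s : slow_fast) (G : geometry) : region :=
  fun x y z => z = z0 G 0 /\ PL2 s G 0 y z /\ PL4 s G 0 y z /\ x = secx G y z.

Definition contains_Pc (s : slow_fast) (G : geometry) (Gamma : region) : Prop :=
  exists x y z, is_Pc s G x y z /\ Gamma x y z.

(* Through P_c, the layer flow from L4 ends at L2, from which one either jumps
   to S_a1 (Gamma_0^L) or follows the reduced flow on S_a2 (Gamma_0^S). *)
Definition is_GammaL (s : slow_fast) (G : geometry) (Gamma : region) : Prop :=
  exists (p q : R * R * R) (C1 C2 C3 C4 C5 : region),
    layer_arc s 0 (fold_pt s G 0 L4 (z0 G 0)) (fold_pt s G 0 L2 (z0 G 0)) C1 /\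
    layer_arc s 0 (fold_pt s G 0 L2 (z0 G 0)) p C2 /\
    (let '(x, y, z) := p in on_sheet s G 0 Sa1 x y z) /\
    reduced_arc s G 0 Sa1 p (fold_pt s G 0 L1 (z0 G 0)) C3 /\
    layer_arc s 0 (fold_pt s G 0 L1 (z0 G 0)) q C4 /\
    (let '(x, y, z) := q in on_sheet s G 0 Sa3 x y z) /\
    reduced_arc s G 0 Sa3 q (fold_pt s G 0 L4 (z0 G 0)) C5 /\
    forall x y z, Gamma x y z <->
      C1 x y z \/ C2 x y z \/ C3 x y z \/ C4 x y z \/ C5 x y z.

Definition is_GammaS (s : slow_fast) (G : geometry) (Gamma : region) : Prop :=
  exists (q : R * R * R) (C1 C2 C3 C4 : region),
    layer_arc s 0 (fold_pt s G 0 L4 (z0 G 0)) (fold_pt s G 0 L2 (z0 G 0)) C1 /\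
    reduced_arc s G 0 Sa2 (fold_pt s G 0 L2 (z0 G 0)) (fold_pt s G 0 L3 (z0 G 0)) C2 /\
    layer_arc s 0 (fold_pt s G 0 L3 (z0 G 0)) q C3 /\
    (let '(x, y, z) := q in on_sheet s G 0 Sa3 x y z) /\
    reduced_arc s G 0 Sa3 q (fold_pt s G 0 L4 (z0 G 0)) C4 /\
    forall x y z, Gamma x y z <->
      C1 x y z \/ C2 x y z \/ C3 x y z \/ C4 x y z.

Definition assumption5 (s : slow_fast) (G : geometry) (GammaL GammaS : region) : Prop :=
  is_GammaL s G GammaL /\ is_GammaS s G GammaS /\
  contains_Pc s G GammaL /\ contains_Pc s G GammaS.

(* [Gf], [Hf] are the functions G, H in g2 = delta G + (z - z0) H. *)
Definition standing_convention (s : slow_fast) (G : geometry)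
    (Gf Hf : R -> R -> R -> R -> R -> R) (GammaL GammaS : region) : Prop :=
  smooth5 Gf /\ smooth5 Hf /\
  (forall x y z, GammaL x y z -> z = z0 G 0) /\
  (forall x y z, GammaS x y z -> z = z0 G 0) /\
  forall x y z eps delta,
    g2 s x y z eps delta =
    delta * Gf x y z eps delta + (z - z0 G 0) * Hf x y z eps delta.

(** * The associated piecewise affine map *)

(* A curve on S (eps = delta = 0) parametrized by x: it runs from
   x = [c_start] to x = [c_end], with z = [c_z] x and y = F(x,z,0,0). *)
Record xcurve := XCurve { c_start : R; c_end : R; c_z : R -> R }.

Definition F_x (s : slow_fast) (x z : R) : R := Derive (fun u => F s u z 0 0) x.

Definition p_int (s : slow_fast) (Hf : R -> R -> R -> R -> R -> R) (c : xcurve)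
    (x : R) : R :=
  let z := c_z c x in let y := F s x z 0 0 in
  Hf x y z 0 0 / g1 s x y z 0 0 * F_x s x z.

Definition q_int (s : slow_fast) (Gf : R -> R -> R -> R -> R -> R) (c : xcurve)
    (x : R) : R :=
  let z := c_z c x in let y := F s x z 0 0 in
  Gf x y z 0 0 / g1 s x y z 0 0 * F_x s x z.

Definition qexp_int (s : slow_fast) (Gf Hf : R -> R -> R -> R -> R -> R) (c : xcurve)
    (x : R) : R :=
  q_int s Gf c x * exp (RInt (p_int s Hf c) x (c_end c)).

Definition M_curve (s : slow_fast) (Gf Hf : R -> R -> R -> R -> R -> R) (c : xcurve)
    (Z : R) : R :=
  exp (RInt (p_int s Hf c) (c_start c) (c_end c)) * Z
  + RInt (qexp_int s Gf Hf c) (c_start c) (c_end c).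

(* [c] is the parametrization by x of [gamma], a piece of S, oriented by the
   reduced flow. [gamma] may or may not contain its endpoints (fold points do
   not belong to the sheets), which does not affect the integrals. The last
   clause ensures that the total operator [RInt] is applied to integrable
   functions. *)
Definition parametrizes (s : slow_fast) (Gf Hf : R -> R -> R -> R -> R -> R)
    (gamma : region) (c : xcurve) : Prop :=
  let a := Rmin (c_start c) (c_end c) in
  let b := Rmax (c_start c) (c_end c) in
  c_start c <> c_end c /\
  (forall x y z, gamma x y z ->
     a <= x <= b /\ z = c_z c x /\ y = F s x z 0 0) /\
  (forall x, a < x < b ->
     gamma x (F s x (c_z c x) 0 0) (c_z c x) /\
     0 < (c_end c - c_start c) *
         reduced_xdot s 0 x (F s x (c_z c x) 0 0) (c_z c x)) /\
  ex_RInt (p_int s Hf c) (c_start c) (c_end c) /\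
  ex_RInt (qexp_int s Gf Hf c) (c_start c) (c_end c).

Definition on_part (s : slow_fast) (G : geometry) (Gamma : region) (j : sheet) : region :=
  fun x y z => Gamma x y z /\ on_sheet s G 0 j x y z.

(* [m] is the PAM associated with the system; a PAM has no value at Z = 0. *)
Definition associated_PAM (s : slow_fast) (G : geometry)
    (Gf Hf : R -> R -> R -> R -> R -> R) (GammaL GammaS : region) (m : R -> R) : Prop :=
  exists cL1 cL3 cS2 cS3 : xcurve,
    parametrizes s Gf Hf (on_part s G GammaL Sa1) cL1 /\
    parametrizes s Gf Hf (on_part s G GammaL Sa3) cL3 /\
    parametrizes s Gf Hf (on_part s G GammaS Sa2) cS2 /\
    parametrizes s Gf Hf (on_part s G GammaS Sa3) cS3 /\
    (forall Z, Z < 0 -> m Z = M_curve s Gf Hf cL3 (M_curve s Gf Hf cL1 Z)) /\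
    (forall Z, 0 < Z -> m Z = M_curve s Gf Hf cS3 (M_curve s Gf Hf cS2 Z)).

(* Main.v *)
Require Import Defs.
From Stdlib Require Import Reals Lra Lia Psatz Ranalysis5.
From Stdlib Require Import ClassicalEpsilon FunctionalExtensionality.
From Coquelicot Require Import Coquelicot.
Open Scope R_scope.

(** One explicit family of systems realizes every map; only two bump amplitudes
    in each of G and H depend on the target.

    The fast equation is x' = y - F(x,z) with F = [quintic], chosen so that
    F_x = 5 (x^2 - 1) (x + 2) (x - 1/10 - z).  The folds are therefore
    x = -2, -1, 1/10 + z, 1, the sheets where F increases attract, and the
    ordering of the fold values makes L1 and L3 jump to the right-hand sheet.
    The coefficients are such that F(-1,z) = 0 and F(1,z) = 40 z / 3,
    so that the heights of L2 and L4 cross transversally at z = 0: orbits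
    leaving L4 reach S_a1, L2 or S_a2 according to the sign of z.

    The slow drift g1 = [drift] equals 1 near the folds L1, L2, L3 and -1 near
    L4.  The other slow component is g2 = delta G + z H, where G and H are
    functions of x supported in two short x-intervals, one inside S_a1 and one
    inside S_a2 ([twist]).  They vanish near all folds and near all landing
    points ([inactive]), hence the switching and transversality conditions only
    involve g1 and hold trivially.

    In the plane z = 0 both singular cycles are explicit: y moves with speed 1
    or -1 on the sheets ([model_reduced_arc]), and the jumps are orbits of a
    scalar autonomous equation, obtained by separation of variables
    ([increasing_orbit]).  Along the cycles p = H F_x and q = G F_x, because
    g1 = 1 wherever G or H is nonzero.  The right-hand sheet contributes the
    identity, and each of the left and middle sheets carries its own bump b:
    with H = alpha b the slope exp (alpha * int b F_x) takes every positive
    value, and with G = kappa b the constant term is kappa times a positive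
    integral ([affine_map_realized]). *)

(** * Calculus of smooth functions *)

Lemma Ck_on_ext {V : NormedModule R_AbsRing} (U : V -> Prop) k (h h' : V -> R) :
  (forall p, h p = h' p) -> Ck_on U k h -> Ck_on U k h'.
Proof.
intros E. destruct k as [|k]; simpl.
- intros H p Up. apply continuous_ext with h; auto.
- intros [Dh [H1 H2]]. exists Dh; split; [|exact H2].
  intros p Up. apply filterdiff_ext with h; auto.
Qed.

Lemma Ck_on_pred {V : NormedModule R_AbsRing} (U : V -> Prop) k (h : V -> R) :
  Ck_on U (S k) h -> Ck_on U k h.
Proof.
revert h; induction k as [|k IH]; intros h [Dh [H1 H2]].
- intros p Up. apply (filterdiff_continuous (V := R_NormedModule) (K := R_AbsRing)).
  exists (Dh p). now apply H1.
- exists Dh; split; [exact H1|]. intros v. now apply IH.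
Qed.

Lemma Ck_on_const {V : NormedModule R_AbsRing} (U : V -> Prop) k (c : R) :
  Ck_on U k (fun _ => c).
Proof.
revert c; induction k as [|k IH]; intros c.
- intros p _. apply continuous_const.
- exists (fun _ _ => 0); split; [|intros; apply IH].
  intros p _. apply (filterdiff_const (F := locally p) (c : R_NormedModule)).
Qed.

Lemma Ck_on_linear {V : NormedModule R_AbsRing} (U : V -> Prop) k (L : V -> R) :
  is_linear L -> Ck_on U k L.
Proof.
intros HL. assert (D : forall p, filterdiff L (locally p) L).
{ intros p. now apply filterdiff_linear. }
destruct k as [|k].
- intros p _. apply (filterdiff_continuous (V := R_NormedModule) (K := R_AbsRing)). exists L. apply D.
- exists (fun _ v => L v); split; [intros; apply D|].
  intros v; apply Ck_on_const.
Qed.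

Lemma Ck_on_plus {V : NormedModule R_AbsRing} (U : V -> Prop) k (h1 h2 : V -> R) :
  Ck_on U k h1 -> Ck_on U k h2 -> Ck_on U k (fun p => h1 p + h2 p).
Proof.
revert h1 h2; induction k as [|k IH]; intros h1 h2.
- intros H1 H2 p Up. apply (continuous_plus h1 h2); auto.
- intros [D1 [H1 K1]] [D2 [H2 K2]].
  exists (fun p v => D1 p v + D2 p v); split.
  + intros p Up. apply (filterdiff_plus_fct (F := locally p) h1 h2); auto.
  + intros v. apply IH; auto.
Qed.

Lemma Ck_on_mult {V : NormedModule R_AbsRing} (U : V -> Prop) k (h1 h2 : V -> R) :
  Ck_on U k h1 -> Ck_on U k h2 -> Ck_on U k (fun p => h1 p * h2 p).
Proof.
revert h1 h2; induction k as [|k IH]; intros h1 h2.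
- intros H1 H2 p Up. apply (continuous_mult h1 h2); auto.
- intros S1 S2. pose proof (Ck_on_pred _ _ _ S1) as P1.
  pose proof (Ck_on_pred _ _ _ S2) as P2.
  destruct S1 as [D1 [H1 K1]]; destruct S2 as [D2 [H2 K2]].
  exists (fun p v => D1 p v * h2 p + h1 p * D2 p v); split.
  + intros p Up. apply (filterdiff_mult_fct (K := R_AbsRing) h1 h2); auto.
    exact Rmult_comm.
  + intros v. apply Ck_on_plus; apply IH; auto.
Qed.

Lemma Ck_on_opp {V : NormedModule R_AbsRing} (U : V -> Prop) k (h : V -> R) :
  Ck_on U k h -> Ck_on U k (fun p => - h p).
Proof.
intros H. apply Ck_on_ext with (fun p => -1 * h p); [intros; ring|].
apply Ck_on_mult; [apply Ck_on_const|exact H].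
Qed.

Lemma Ck_on_minus {V : NormedModule R_AbsRing} (U : V -> Prop) k (h1 h2 : V -> R) :
  Ck_on U k h1 -> Ck_on U k h2 -> Ck_on U k (fun p => h1 p - h2 p).
Proof.
intros H1 H2. apply Ck_on_plus; [exact H1|now apply Ck_on_opp].
Qed.

Lemma Ck_on_pow {V : NormedModule R_AbsRing} (U : V -> Prop) k (h : V -> R) n :
  Ck_on U k h -> Ck_on U k (fun p => h p ^ n).
Proof.
intros H; induction n as [|n IH]; [exact (Ck_on_const U k 1)|].
apply (Ck_on_mult U k h (fun p => h p ^ n)); auto.
Qed.

Lemma filterdiff_comp_derive {V : NormedModule R_AbsRing} (phi : R -> R) (h : V -> R)
    (p : V) (l : V -> R) (d : R) :
  filterdiff h (locally p) l -> is_derive phi (h p) d ->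
  filterdiff (fun q => phi (h q)) (locally p) (fun v => l v * d).
Proof.
intros Hh Hphi. exact (filterdiff_comp' h phi p l (fun y => scal y d) Hh Hphi).
Qed.

Lemma Ck_on_inv {V : NormedModule R_AbsRing} (U : V -> Prop) k (h : V -> R) :
  (forall p, U p -> h p <> 0) -> Ck_on U k h -> Ck_on U k (fun p => / h p).
Proof.
intros Hnz. induction k as [|k IH]; intros Sh.
- intros p Up. apply (continuous_comp h Rinv); [now apply Sh|].
  apply continuity_pt_filterlim. apply (continuity_pt_inv (fun x => x)).
  + apply derivable_continuous_pt, derivable_pt_id.
  + now apply Hnz.
- pose proof (IH (Ck_on_pred _ _ _ Sh)) as IHh.
  destruct Sh as [D [H K]].
  exists (fun p v => D p v * (- (/ h p * / h p))); split.
  + intros p Up. apply filterdiff_comp_derive; [now apply H|].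
    pose proof (Hnz p Up). auto_derive; [assumption|now field].
  + intros v. apply Ck_on_mult; [apply K|].
    now apply Ck_on_opp, Ck_on_mult.
Qed.

(** Chain rule for a sequence [phi] of functions of one variable whose span is
    closed under differentiation; the derivatives of exp(-1/x) form such a
    sequence. *)
Lemma Ck_on_comp {V : NormedModule R_AbsRing} (U : V -> Prop) (phi : nat -> R -> R) :
  (forall n x, is_derive (phi n) x (phi (n + 2)%nat x - INR n * phi (n + 1)%nat x)) ->
  forall k n (h : V -> R), Ck_on U k h -> Ck_on U k (fun p => phi n (h p)).
Proof.
intros Hphi. induction k as [|k IH]; intros n h Sh.
- intros p Up. apply (continuous_comp h (phi n)); [now apply Sh|].
  apply (ex_derive_continuous (phi n)). eexists; apply Hphi.
- pose proof (Ck_on_pred _ _ _ Sh) as Ph. destruct Sh as [D [H K]].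
  exists (fun p v => D p v *
            (phi (n + 2)%nat (h p) - INR n * phi (n + 1)%nat (h p))); split.
  + intros p Up. apply filterdiff_comp_derive; [now apply H|apply Hphi].
  + intros v. apply Ck_on_mult; [apply K|].
    apply Ck_on_minus; [now apply IH|].
    apply Ck_on_mult; [apply Ck_on_const|now apply IH].
Qed.

(** * A smooth step and smooth bumps *)

(** Raise u <= exp u, for u = t / n, to the power n. *)
Lemma pow_le_exp n t : 0 <= t -> t ^ n <= INR n ^ n * exp t.
Proof.
intros Ht. destruct (Nat.eq_dec n 0) as [->|Hn].
{ simpl. pose proof (exp_ineq1_le t). lra. }
assert (Hn' : 0 < INR n) by (apply lt_0_INR; lia).
assert (E : forall m u, exp (INR m * u) = exp u ^ m).
{ intros m u. induction m as [|m IH].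
  - rewrite Rmult_0_l. apply exp_0.
  - rewrite S_INR, Rmult_plus_distr_r, Rmult_1_l, exp_plus, IH. simpl. ring. }
replace t with (INR n * (t / INR n)) at 2 by (field; lra).
rewrite E, <- Rpow_mult_distr. apply pow_incr. split; [exact Ht|].
apply Rle_trans with (INR n * (t / INR n)); [right; field; lra|].
apply Rmult_le_compat_l; [lra|].
pose proof (exp_ineq1_le (t / INR n)). lra.
Qed.

(** The functions x^(-n) exp(-1/x), extended by 0: their span contains all
    derivatives of exp(-1/x). *)
Definition flat (n : nat) (x : R) : R :=
  if Rlt_dec 0 x then (/ x) ^ n * exp (- / x) else 0.

Lemma flat_pos n x : 0 < x -> 0 < flat n x.
Proof.
intros Hx. unfold flat. destruct (Rlt_dec 0 x); [|lra].
apply Rmult_lt_0_compat; [|apply exp_pos].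
apply pow_lt. now apply Rinv_0_lt_compat.
Qed.

Lemma flat_zero n x : x <= 0 -> flat n x = 0.
Proof. intros Hx. unfold flat. destruct (Rlt_dec 0 x); [lra|reflexivity]. Qed.

Lemma flat_nonneg n x : 0 <= flat n x.
Proof.
destruct (Rlt_or_le 0 x) as [H|H]; [now left; apply flat_pos|].
rewrite flat_zero; lra.
Qed.

Lemma flat_quadratic n x : flat n x <= INR (n + 2) ^ (n + 2) * x ^ 2.
Proof.
assert (HC : 0 <= INR (n + 2) ^ (n + 2)) by (apply pow_le, pos_INR).
destruct (Rlt_or_le 0 x) as [H|H].
2:{ rewrite flat_zero by lra. apply Rmult_le_pos; [lra|apply pow2_ge_0]. }
unfold flat. destruct (Rlt_dec 0 x); [|lra].
assert (Hi : 0 < / x) by now apply Rinv_0_lt_compat.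
pose proof (pow_le_exp (n + 2) (/ x) (Rlt_le _ _ Hi)) as B.
rewrite pow_add in B.
assert (Hx2 : 0 < x ^ 2) by now apply pow_lt.
apply Rmult_le_compat_r with (r := x ^ 2 * exp (- / x)) in B.
2:{ apply Rmult_le_pos; [lra|left; apply exp_pos]. }
replace ((/ x) ^ n * (/ x) ^ 2 * (x ^ 2 * exp (- / x)))
  with ((/ x) ^ n * exp (- / x)) in B by (field; lra).
replace (INR (n + 2) ^ (n + 2) * exp (/ x) * (x ^ 2 * exp (- / x)))
  with (INR (n + 2) ^ (n + 2) * x ^ 2 * (exp (/ x) * exp (- / x))) in B by ring.
rewrite <- exp_plus, Rplus_opp_r, exp_0 in B. lra.
Qed.

(** At x = 0 the quadratic bound makes the difference quotient vanish; the
    recursion itself is the product rule for x > 0. *)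
Lemma is_derive_flat n x :
  is_derive (flat n) x (flat (n + 2) x - INR n * flat (n + 1) x).
Proof.
destruct (Rtotal_order x 0) as [H|[->|H]].
- rewrite !flat_zero by lra. rewrite Rmult_0_r, Rminus_0_r.
  apply is_derive_ext_loc with (fun _ => 0); [|apply @is_derive_const].
  apply (locally_interval _ x m_infty 0); simpl; auto.
  intros y _ Hy. rewrite flat_zero; auto; lra.
- rewrite !flat_zero by lra. rewrite Rmult_0_r, Rminus_0_r.
  apply is_derive_Reals. intros eps Heps.
  set (C := INR (n + 2) ^ (n + 2)).
  assert (HC : 0 <= C) by (apply pow_le, pos_INR).
  assert (Hd : 0 < eps / (C + 1)) by (apply Rdiv_lt_0_compat; lra).
  exists (mkposreal _ Hd). intros h Hh Hlt. simpl in Hlt.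
  rewrite Rplus_0_l, (flat_zero n 0), !Rminus_0_r by lra.
  unfold Rdiv. rewrite Rabs_mult, (Rabs_pos_eq (flat n h)) by apply flat_nonneg.
  rewrite Rabs_inv.
  pose proof (flat_quadratic n h) as B. fold C in B.
  rewrite <- (pow2_abs h) in B.
  assert (Hp : 0 < Rabs h) by now apply Rabs_pos_lt.
  apply Rle_lt_trans with (C * Rabs h ^ 2 * / Rabs h).
  { apply Rmult_le_compat_r; [|exact B]. left; now apply Rinv_0_lt_compat. }
  replace (C * Rabs h ^ 2 * / Rabs h) with (C * Rabs h) by (field; lra).
  apply Rle_lt_trans with ((C + 1) * Rabs h); [nra|].
  apply Rmult_lt_compat_l with (r := C + 1) in Hlt; [|lra].
  replace ((C + 1) * (eps / (C + 1))) with eps in Hlt by (field; lra).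
  exact Hlt.
- apply is_derive_ext_loc with (fun x => (/ x) ^ n * exp (- / x)).
  { apply (locally_interval _ x 0 p_infty); simpl; auto.
    intros y Hy _. unfold flat. destruct (Rlt_dec 0 y); [reflexivity|lra]. }
  unfold flat. destruct (Rlt_dec 0 x); [|lra].
  auto_derive; [lra|].
  destruct n as [|n]; [simpl; field; lra|].
  rewrite !Nat.add_succ_l, S_INR. simpl pred.
  replace (n + 2)%nat with (S (S n)) by lia.
  replace (n + 1)%nat with (S n) by lia. simpl pow. field; lra.
Qed.

Lemma Ck_on_flat {V : NormedModule R_AbsRing} (U : V -> Prop) k n (h : V -> R) :
  Ck_on U k h -> Ck_on U k (fun p => flat n (h p)).
Proof. apply Ck_on_comp. exact is_derive_flat. Qed.


(** * Inverses of monotone functions and scalar autonomous equations *)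

Lemma increasing_inverse (J : R -> Prop) (T : R -> R) :
  (forall x, J x -> exists e, 0 < e /\ forall y, Rabs (y - x) < e -> J y) ->
  (forall x y, J x -> J y -> x < y -> T x < T y) ->
  (forall t, exists x, J x /\ T x = t) ->
  exists phi, (forall t, J (phi t) /\ T (phi t) = t) /\
              (forall t, continuous phi t).
Proof.
intros Jop Tinc Tsur.
set (phi := fun t => proj1_sig (constructive_indefinite_description _ (Tsur t))).
assert (Hphi : forall t, J (phi t) /\ T (phi t) = t).
{ intros t. exact (proj2_sig (constructive_indefinite_description _ (Tsur t))). }
exists phi; split; [exact Hphi|].
assert (Tle : forall x y, J x -> J y -> T x < T y -> x < y).
{ intros x y Jx Jy H. destruct (Rtotal_order x y) as [|[->|H']]; [auto|lra|].
  pose proof (Tinc y x Jy Jx H'). lra. }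
intros t. apply continuity_pt_filterlim. intros eps Heps.
destruct (Hphi t) as [Jt Et]. destruct (Jop _ Jt) as [e [He Je]].
set (d := Rmin e eps / 2).
assert (Hd : 0 < d < e /\ d < eps).
{ unfold d. pose proof (Rmin_l e eps). pose proof (Rmin_r e eps).
  pose proof (Rmin_pos e eps He Heps). lra. }
assert (J1 : J (phi t - d)) by (apply Je; rewrite Rabs_left; lra).
assert (J2 : J (phi t + d)) by (apply Je; rewrite Rabs_pos_eq; lra).
assert (T1 : T (phi t - d) < t) by (rewrite <- Et at 2; apply Tinc; auto; lra).
assert (T2 : t < T (phi t + d)) by (rewrite <- Et at 1; apply Tinc; auto; lra).
exists (Rmin (t - T (phi t - d)) (T (phi t + d) - t)). split.
{ apply Rmin_pos; lra. }
intros s [_ Hs]. unfold R_dist in *. simpl in *. unfold R_dist in *.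
pose proof (Rmin_l (t - T (phi t - d)) (T (phi t + d) - t)).
pose proof (Rmin_r (t - T (phi t - d)) (T (phi t + d) - t)).
apply Rabs_def2 in Hs. destruct (Hphi s) as [Js Es].
assert (phi t - d < phi s) by (apply Tle; auto; lra).
assert (phi s < phi t + d) by (apply Tle; auto; lra).
apply Rabs_def1; lra.
Qed.

Lemma is_derive_right_inverse (T phi : R -> R) (t d : R) :
  (forall s, T (phi s) = s) -> continuous phi t ->
  is_derive T (phi t) d -> d <> 0 -> is_derive phi t (/ d).
Proof.
intros HT Hc HD Hd. apply is_derive_Reals in HD. apply is_derive_Reals.
apply continuity_pt_filterlim in Hc.
intros eps Heps.
assert (Hinv : continuity_pt Rinv d).
{ apply (continuity_pt_inv (fun x => x)); [|exact Hd].
  apply derivable_continuous_pt, derivable_pt_id. }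
destruct (Hinv eps Heps) as [e1 [He1 H1]].
destruct (HD e1 He1) as [[e2 He2] H2]. simpl in H2.
destruct (Hc e2 He2) as [e3 [He3 H3]].
exists (mkposreal e3 He3). intros h Hh Hlt. simpl in Hlt.
set (k := phi (t + h) - phi t).
assert (Ek : phi t + k = phi (t + h)) by (unfold k; ring).
assert (Hk : k <> 0).
{ intros E. rewrite E, Rplus_0_r in Ek.
  pose proof (HT (t + h)). rewrite <- Ek, HT in H. lra. }
assert (Hk2 : Rabs k < e2).
{ apply (H3 (t + h)). split.
  - split; [exact I|lra].
  - simpl. unfold R_dist. now replace (t + h - t) with h by ring. }
specialize (H2 k Hk Hk2). rewrite Ek, !HT in H2.
replace (t + h - t) with h in H2 by ring.
destruct (Req_dec (h / k) d) as [E|E].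
- replace (k / h) with (/ d) by (rewrite <- E; field; auto).
  rewrite Rminus_diag, Rabs_R0. exact Heps.
- replace (k / h) with (/ (h / k)) by (field; auto).
  apply (H1 (h / k)). split; [|exact H2]. split; [exact I|auto].
Qed.

Lemma le_of_derive_nonneg (h dh : R -> R) (x y : R) :
  x <= y -> (forall u, x <= u <= y -> is_derive h u (dh u)) ->
  (forall u, x <= u <= y -> 0 <= dh u) -> h x <= h y.
Proof.
intros Hxy HD Hp.
destruct (MVT_gen h x y dh) as [c [Hc E]].
- intros u Hu. rewrite Rmin_left, Rmax_right in Hu by lra. apply HD; lra.
- intros u Hu. rewrite Rmin_left, Rmax_right in Hu by lra.
  apply continuity_pt_filterlim, (ex_derive_continuous h). eexists; apply HD; lra.
- rewrite Rmin_left, Rmax_right in Hc by lra.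
  assert (0 <= dh c * (y - x)) by (apply Rmult_le_pos; [apply Hp|]; lra). lra.
Qed.

(** Separation of variables: the time to reach x from x0 is the integral of
    1/g. The linear bounds on g at the endpoints make this time infinite there,
    so that its inverse is defined for all times. *)
Lemma increasing_orbit (g : R -> R) (a b K x0 : R) :
  a < x0 < b -> 0 < K ->
  (forall x, a < x < b -> continuous g x) ->
  (forall x, a < x < b -> 0 < g x) ->
  (forall x, a < x < b -> g x <= K * (x - a)) ->
  (forall x, a < x < b -> g x <= K * (b - x)) ->
  exists phi : R -> R, phi 0 = x0 /\ (forall t, a < phi t < b) /\
    (forall s t, s <= t -> phi s <= phi t) /\
    (forall t, is_derive phi t (g (phi t))) /\
    is_lim phi m_infty a /\ is_lim phi p_infty b.
Proof.
intros Hx0 HK Hc Hg Ha Hb.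
set (T := (fun x => RInt (fun u => / g u) x0 x) : R -> R).
assert (Hc' : forall x, a < x < b -> continuous (fun u => / g u) x).
{ intros x Hx. apply (continuous_comp g Rinv); [now apply Hc|].
  apply continuity_pt_filterlim, (continuity_pt_inv (fun x => x)).
  - apply derivable_continuous_pt, derivable_pt_id.
  - pose proof (Hg x Hx). lra. }
assert (HI : forall x, a < x < b -> ex_RInt (fun u => / g u) x0 x).
{ intros x Hx. apply (ex_RInt_continuous (V := R_CompleteNormedModule)).
  intros u Hu. apply Hc'.
  unfold Rmin, Rmax in Hu. destruct (Rle_dec x0 x); lra. }
assert (DT : forall x, a < x < b -> is_derive T x (/ g x)).
{ intros x Hx. apply (is_derive_RInt (fun u => / g u) T x0 x); [|now apply Hc'].
  apply (locally_interval _ x a b); simpl; try tauto.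
  intros y Hya Hyb. apply (RInt_correct (V := R_CompleteNormedModule)), HI; lra. }
assert (T0 : T x0 = 0) by exact (RInt_point x0 (fun u => / g u)).
assert (Tinc : forall x y, a < x < b -> a < y < b -> x < y -> T x < T y).
{ intros x y Hx Hy Hxy.
  apply (incr_function T a b (fun u => / g u)); simpl; try tauto.
  - intros; apply DT; lra.
  - intros; apply Rinv_0_lt_compat, Hg; lra. }
assert (Tup : forall m, 0 < m -> exists x, x0 < x < b /\ m <= T x).
{ intros m Hm. set (x := b - (b - x0) * exp (- (K * m))).
  assert (HKm : 0 < K * m) by now apply Rmult_lt_0_compat.
  assert (He : 0 < exp (- (K * m)) < 1).
  { split; [apply exp_pos|]. rewrite <- exp_0. apply exp_increasing. lra. }
  assert (Hx : x0 < x < b) by (unfold x; nra).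
  exists x; split; [exact Hx|].
  pose proof (le_of_derive_nonneg (fun u => T u + ln (b - u) / K)
    (fun u => / g u - / (K * (b - u))) x0 x) as L.
  cbv beta in L. rewrite T0 in L.
  assert (L' : 0 + ln (b - x0) / K <= T x + ln (b - x) / K).
  { apply L; [lra| |].
    - intros u Hu. evar_last.
      + apply (is_derive_plus T (fun u => ln (b - u) / K)); [apply DT; lra|].
        auto_derive; [lra|reflexivity].
      + unfold plus; simpl. field. split; [lra|split; [lra|]].
        pose proof (Hg u). lra.
    - intros u Hu. assert (Hu' : a < u < b) by lra.
      pose proof (Hg u Hu'). pose proof (Hb u Hu').
      assert (/ (K * (b - u)) <= / g u) by (apply Rinv_le_contravar; lra). lra. }
  replace (b - x) with ((b - x0) * exp (- (K * m))) in L' by (unfold x; ring).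
  rewrite ln_mult, ln_exp in L' by lra.
  replace ((ln (b - x0) + - (K * m)) / K) with (ln (b - x0) / K - m) in L'
    by (field; lra). lra. }
assert (Tdn : forall m, 0 < m -> exists x, a < x < x0 /\ T x <= - m).
{ intros m Hm. set (x := a + (x0 - a) * exp (- (K * m))).
  assert (HKm : 0 < K * m) by now apply Rmult_lt_0_compat.
  assert (He : 0 < exp (- (K * m)) < 1).
  { split; [apply exp_pos|]. rewrite <- exp_0. apply exp_increasing. lra. }
  assert (Hx : a < x < x0) by (unfold x; nra).
  exists x; split; [exact Hx|].
  pose proof (le_of_derive_nonneg (fun u => T u - ln (u - a) / K)
    (fun u => / g u - / (K * (u - a))) x x0) as L.
  cbv beta in L. rewrite T0 in L.
  assert (L' : T x - ln (x - a) / K <= 0 - ln (x0 - a) / K).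
  { apply L; [lra| |].
    - intros u Hu. evar_last.
      + apply (is_derive_minus T (fun u => ln (u - a) / K)); [apply DT; lra|].
        auto_derive; [lra|reflexivity].
      + unfold minus, plus, opp; simpl. field. split; [lra|split; [lra|]].
        pose proof (Hg u). lra.
    - intros u Hu. assert (Hu' : a < u < b) by lra.
      pose proof (Hg u Hu'). pose proof (Ha u Hu').
      assert (/ (K * (u - a)) <= / g u) by (apply Rinv_le_contravar; lra). lra. }
  replace (x - a) with ((x0 - a) * exp (- (K * m))) in L' by (unfold x; ring).
  rewrite ln_mult, ln_exp in L' by lra.
  replace ((ln (x0 - a) + - (K * m)) / K) with (ln (x0 - a) / K - m) in L'
    by (field; lra). lra. }
destruct (increasing_inverse (fun x => a < x < b) T) as [phi [Hphi Cphi]].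
- intros x Hx. exists (Rmin (x - a) (b - x)). split; [apply Rmin_pos; lra|].
  intros y Hy. pose proof (Rmin_l (x - a) (b - x)).
  pose proof (Rmin_r (x - a) (b - x)). apply Rabs_def2 in Hy. lra.
- exact Tinc.
- intros t. pose proof (Rabs_pos t). pose proof (Rle_abs t).
  pose proof (Rle_abs (- t)) as Hn. rewrite Rabs_Ropp in Hn.
  destruct (Tup (Rabs t + 1)) as [x2 [Hx2 Ht2]]; [lra|].
  destruct (Tdn (Rabs t + 1)) as [x1 [Hx1 Ht1]]; [lra|].
  destruct (IVT_interv (fun x => T x - t) x1 x2) as [x [Hx E]]; [|lra|lra|lra|].
  + intros u Hu. apply continuity_pt_filterlim.
    apply (ex_derive_continuous (fun x => T x - t)).
    eexists. apply (is_derive_minus T (fun _ => t)); [apply DT; lra|].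
    apply @is_derive_const.
  + exists x. split; lra.
- assert (Pin : forall t, a < phi t < b) by (intros; apply Hphi).
  assert (PT : forall t, T (phi t) = t) by (intros; apply Hphi).
  assert (Plt : forall x t, a < x < b -> T x < t -> x < phi t).
  { intros x t Hx Ht. destruct (Rlt_or_le x (phi t)) as [|[L|E]]; [auto| |].
    - pose proof (Tinc _ _ (Pin t) Hx L). rewrite PT in H. lra.
    - rewrite <- E, PT in Ht. lra. }
  assert (Pgt : forall x t, a < x < b -> t < T x -> phi t < x).
  { intros x t Hx Ht. destruct (Rlt_or_le (phi t) x) as [|[L|E]]; [auto| |].
    - pose proof (Tinc _ _ Hx (Pin t) L). rewrite PT in H. lra.
    - rewrite E, PT in Ht. lra. }
  exists phi. split; [|split; [exact Pin|split; [|split; [|split]]]].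
  + destruct (Rtotal_order (phi 0) x0) as [L|[E|L]]; [|exact E|].
    * pose proof (Tinc _ _ (Pin 0) Hx0 L). rewrite PT in H. lra.
    * pose proof (Tinc _ _ Hx0 (Pin 0) L). rewrite PT in H. lra.
  + intros s t [H| ->]; [|lra].
    left. apply Plt; [apply Pin|]. now rewrite PT.
  + intros t. rewrite <- (Rinv_inv (g (phi t))).
    apply is_derive_right_inverse with T; auto.
    apply Rinv_neq_0_compat. pose proof (Hg _ (Pin t)). lra.
  + apply is_lim_spec. intros [eps Heps]. simpl.
    set (x := a + Rmin eps (b - a) / 2).
    pose proof (Rmin_l eps (b - a)). pose proof (Rmin_r eps (b - a)).
    assert (0 < Rmin eps (b - a)) by (apply Rmin_pos; lra).
    exists (T x). intros t Ht.
    assert (phi t < x) by (apply Pgt; [unfold x; lra|exact Ht]).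
    pose proof (Pin t). rewrite Rabs_pos_eq by lra. unfold x in *; lra.
  + apply is_lim_spec. intros [eps Heps]. simpl.
    set (x := b - Rmin eps (b - a) / 2).
    pose proof (Rmin_l eps (b - a)). pose proof (Rmin_r eps (b - a)).
    assert (0 < Rmin eps (b - a)) by (apply Rmin_pos; lra).
    exists (T x). intros t Ht.
    assert (x < phi t) by (apply Plt; [unfold x; lra|exact Ht]).
    pose proof (Pin t). rewrite Rabs_left by lra. unfold x in *; lra.
Qed.

Lemma decreasing_orbit (g : R -> R) (a b K x0 : R) :
  a < x0 < b -> 0 < K ->
  (forall x, a < x < b -> continuous g x) ->
  (forall x, a < x < b -> g x < 0) ->
  (forall x, a < x < b -> - g x <= K * (x - a)) ->
  (forall x, a < x < b -> - g x <= K * (b - x)) ->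
  exists phi : R -> R, phi 0 = x0 /\ (forall t, a < phi t < b) /\
    (forall s t, s <= t -> phi t <= phi s) /\
    (forall t, is_derive phi t (g (phi t))) /\
    is_lim phi m_infty b /\ is_lim phi p_infty a.
Proof.
intros Hx0 HK Hc Hg Ha Hb.
destruct (increasing_orbit (fun u => - g (- u)) (- b) (- a) K (- x0))
  as [psi [P0 [Pin [Pm [Pd [Pl Pr]]]]]].
- lra.
- exact HK.
- intros x Hx. apply (continuous_opp (fun u => g (- u))).
  apply (continuous_comp Ropp g); [|apply Hc; lra].
  apply (continuous_opp (fun u : R => u)), continuous_id.
- intros x Hx. pose proof (Hg (- x)). lra.
- intros x Hx. pose proof (Hb (- x)). lra.
- intros x Hx. pose proof (Ha (- x)). lra.
- exists (fun t => - psi t). split; [|split; [|split; [|split; [|split]]]].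
  + lra.
  + intros t. pose proof (Pin t); lra.
  + intros s t Hst. pose proof (Pm s t Hst). lra.
  + intros t. replace (g (- psi t)) with (- (- g (- psi t))) by ring.
    apply (is_derive_opp psi), Pd.
  + replace (Finite b) with (Rbar_opp (Finite (- b))) by (simpl; f_equal; ring).
    now apply is_lim_opp.
  + replace (Finite a) with (Rbar_opp (Finite (- a))) by (simpl; f_equal; ring).
    now apply is_lim_opp.
Qed.


Lemma lt_of_derive_pos (h dh : R -> R) (x y : R) :
  x < y -> (forall u, x <= u <= y -> is_derive h u (dh u)) ->
  (forall u, x < u < y -> 0 < dh u) -> h x < h y.
Proof.
intros Hxy HD Hp.
destruct (MVT_cor2 h dh x y Hxy) as [c [E Hc]].
- intros u Hu. now apply is_derive_Reals, HD.
- pose proof (Hp c Hc). assert (0 < dh c * (y - x)) by (apply Rmult_lt_0_compat; lra). lra.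
Qed.

Lemma intermediate_value (h : R -> R) (a b y : R) :
  a < b -> (forall x, a <= x <= b -> continuous h x) -> h a < y < h b ->
  exists x, a < x < b /\ h x = y.
Proof.
intros Hab Hc Hy.
destruct (IVT_interv (fun x => h x - y) a b) as [x [Hx E]]; try lra.
- intros u Hu. apply continuity_pt_filterlim.
  apply (continuous_minus h (fun _ => y)); [now apply Hc|apply continuous_const].
- exists x. assert (h x = y) by lra. split; [|assumption].
  split; apply Rnot_le_lt; intros Hle.
  + assert (x = a) by lra. subst x. lra.
  + assert (x = b) by lra. subst x. lra.
Qed.

(** Extending [h] affinely beyond the segment makes its inverse continuous on
    the whole line, in particular two-sidedly at the endpoints. *)
Lemma increasing_segment_inverse (h : R -> R) (a b : R) :
  a < b -> (forall x, a <= x <= b -> continuous h x) ->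
  (forall x y, a <= x -> x < y -> y <= b -> h x < h y) ->
  exists phi : R -> R, (forall t, continuous phi t) /\
    (forall x, a <= x <= b -> phi (h x) = x).
Proof.
intros Hab Hc Hi.
set (cl := fun x => Rmax a (Rmin x b)).
set (T := fun x => h (cl x) + (x - cl x)).
assert (Hcl : forall x, a <= cl x <= b).
{ intros x. unfold cl, Rmax, Rmin. destruct (Rle_dec x b);
  destruct (Rle_dec a _); lra. }
assert (Tin : forall x, a <= x <= b -> T x = h x).
{ intros x Hx. unfold T. replace (cl x) with x; [ring|].
  unfold cl. rewrite Rmin_left, Rmax_right; lra. }
assert (Tinc : forall x y, x < y -> T x < T y).
{ intros x y Hxy.
  assert (cl x <= cl y /\ x - cl x <= y - cl y).
  { unfold cl, Rmin. destruct (Rle_dec x b); destruct (Rle_dec y b);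
    unfold Rmax; repeat match goal with
      |- context [Rle_dec ?u ?v] => destruct (Rle_dec u v) end; lra. }
  destruct (Rle_lt_or_eq_dec (cl x) (cl y)) as [L|E]; [lra| |].
  - pose proof (Hcl x). pose proof (Hcl y).
    assert (h (cl x) < h (cl y)) by (apply Hi; lra). unfold T. lra.
  - unfold T. rewrite E. lra. }
destruct (increasing_inverse (fun _ => True) T) as [phi [H1 H2]].
- intros x _. exists 1. split; [lra|auto].
- auto.
- intros t. destruct (Rlt_or_le (h a) t) as [La|La].
  + destruct (Rlt_or_le t (h b)) as [Lb|Lb].
    * destruct (intermediate_value h a b t) as [x [Hx E]]; auto.
      exists x. split; [exact I|]. rewrite Tin; [exact E|lra].
    * exists (b + (t - h b)). split; [exact I|]. unfold T.
      replace (cl (b + (t - h b))) with b; [ring|].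
      unfold cl. rewrite Rmin_right, Rmax_right; lra.
  + exists (a + (t - h a)). split; [exact I|]. unfold T.
    replace (cl (a + (t - h a))) with a; [ring|].
    unfold cl. rewrite Rmin_left, Rmax_left; lra.
- exists phi. split; [exact H2|]. intros x Hx.
  pose proof (proj2 (H1 (h x))) as E. rewrite <- (Tin x Hx) in E at 2.
  destruct (Rtotal_order (phi (h x)) x) as [L|[L|L]]; [|exact L|];
  apply Tinc in L; lra.
Qed.

Lemma RInt_pos_of_pos_on_subinterval (h : R -> R) (a b c d : R) :
  a <= c -> c < d -> d <= b -> (forall x, continuous h x) ->
  (forall x, a < x < b -> 0 <= h x) -> (forall x, c < x < d -> 0 < h x) ->
  0 < RInt h a b.
Proof.
intros Hac Hcd Hdb Hc Hn Hp.
assert (E : forall u v, ex_RInt h u v).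
{ intros u v. apply (ex_RInt_continuous (V := R_CompleteNormedModule)); auto. }
rewrite <- (RInt_Chasles h a c b), <- (RInt_Chasles h c d b) by auto.
unfold plus; simpl.
assert (0 < RInt h c d) by (apply RInt_gt_0; auto).
assert (0 <= RInt h a c) by (apply RInt_ge_0; auto; intros; apply Hn; lra).
assert (0 <= RInt h d b) by (apply RInt_ge_0; auto; intros; apply Hn; lra).
lra.
Qed.

(** * The model system *)

Definition quintic (x z : R) : R :=
  (x + 1) ^ 2 * ((x - 1) ^ 2 * (x + 19 / 8)
                 - 5 / 12 * z * (3 * x ^ 2 + 2 * x - 13)).

Definition quintic_x (x z : R) : R :=
  5 * ((x - 1) * (x + 1) * (x + 2) * (x - (1 / 10 + z))).

(** For such z the fold at 1/10 + z lies between -1 and 1 and its height is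
    below that of L1, and the height 40 z / 3 of L4 is too small for its landing
    points to reach the supports of the bumps. *)
Definition small_z (z : R) : Prop := - (1 / 100) < z < 1 / 100.

Definition step (u : R) : R := flat 0 u / (flat 0 u + flat 0 (1 - u)).

(** Upward (1) to the left of 1/2 and downward (-1) to the right of 3/4; the
    sign change takes place on the repelling sheet between L3 and L4. *)
Definition drift (x : R) : R := 1 - 2 * step (4 * x - 2).

Definition bump (a b x : R) : R := flat 0 (x - a) * flat 0 (b - x).

Definition twist (c1 c2 x : R) : R :=
  c1 * bump (- (9 / 4)) (- (17 / 8)) x + c2 * bump (- (1 / 2)) (- (1 / 4)) x.

Definition model (k h : R -> R) : slow_fast :=
  SlowFast (fun x z _ _ => quintic x z)
           (fun x _ _ _ _ => drift x)
           (fun x _ z _ delta => delta * k x + z * h x).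

Definition folds (i : fold) (z : R) : R :=
  match i with L1 => - 2 | L2 => - 1 | L3 => 1 / 10 + z | L4 => 1 end.

Definition model_geometry : geometry :=
  Geometry (- (1 / 100)) (1 / 100) 1 (fun i z _ => folds i z)
    (fun y z => small_z z /\ -1 < y < 1) (fun _ _ => 0) (fun _ => 0).

(** The complement of the two open intervals where [twist] acts. It contains
    neighbourhoods of all folds and all landing points of the jumps from them. *)
Definition inactive (x : R) : Prop :=
  x <= - (9 / 4) \/ - (17 / 8) <= x <= - (1 / 2) \/ - (1 / 4) <= x.

Definition localized (h : R -> R) : Prop := forall x, inactive x -> h x = 0.

Lemma is_derive_quintic x z : is_derive (fun u => quintic u z) x (quintic_x x z).
Proof. unfold quintic, quintic_x. auto_derive; [exact I|]. field. Qed.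

Lemma continuous_quintic x z : continuous (fun u => quintic u z) x.
Proof.
apply (ex_derive_continuous (fun u => quintic u z)).
eexists; apply is_derive_quintic.
Qed.

Lemma quintic_fold1 z : quintic (-2) z = 27 / 8 + 25 / 12 * z.
Proof. unfold quintic. field. Qed.

Lemma quintic_fold2 z : quintic (-1) z = 0.
Proof. unfold quintic. ring. Qed.

Lemma quintic_fold4 z : quintic 1 z = 40 / 3 * z.
Proof. unfold quintic. field. Qed.

Lemma quintic_x_pos1 x z : small_z z -> x < -2 -> 0 < quintic_x x z.
Proof.
unfold small_z; intros Hz Hx. unfold quintic_x.
replace (5 * ((x - 1) * (x + 1) * (x + 2) * (x - (1 / 10 + z)))) with
  (5 * ((1 - x) * (-1 - x) * (-2 - x) * (1 / 10 + z - x))) by ring.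
repeat apply Rmult_lt_0_compat; lra.
Qed.

Lemma quintic_x_neg1 x z : small_z z -> -2 < x < -1 -> quintic_x x z < 0.
Proof.
unfold small_z; intros Hz Hx. unfold quintic_x. apply Ropp_lt_cancel. rewrite Ropp_0.
replace (- (5 * ((x - 1) * (x + 1) * (x + 2) * (x - (1 / 10 + z))))) with
  (5 * ((1 - x) * (-1 - x) * (x + 2) * (1 / 10 + z - x))) by ring.
repeat apply Rmult_lt_0_compat; lra.
Qed.

Lemma quintic_x_pos2 x z : small_z z -> -1 < x < 1 / 10 + z -> 0 < quintic_x x z.
Proof.
unfold small_z; intros Hz Hx. unfold quintic_x.
replace (5 * ((x - 1) * (x + 1) * (x + 2) * (x - (1 / 10 + z)))) with
  (5 * ((1 - x) * (x + 1) * (x + 2) * (1 / 10 + z - x))) by ring.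
repeat apply Rmult_lt_0_compat; lra.
Qed.

Lemma quintic_x_neg2 x z : small_z z -> 1 / 10 + z < x < 1 -> quintic_x x z < 0.
Proof.
unfold small_z; intros Hz Hx. unfold quintic_x. apply Ropp_lt_cancel. rewrite Ropp_0.
replace (- (5 * ((x - 1) * (x + 1) * (x + 2) * (x - (1 / 10 + z))))) with
  (5 * ((1 - x) * (x + 1) * (x + 2) * (x - (1 / 10 + z)))) by ring.
repeat apply Rmult_lt_0_compat; lra.
Qed.

Lemma quintic_x_pos3 x z : small_z z -> 1 < x -> 0 < quintic_x x z.
Proof.
unfold small_z; intros Hz Hx. unfold quintic_x.
repeat apply Rmult_lt_0_compat; lra.
Qed.

Lemma quintic_lt_of_pos z x y : x < y ->
  (forall u, x < u < y -> 0 < quintic_x u z) -> quintic x z < quintic y z.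
Proof.
intros Hxy Hp.
apply (lt_of_derive_pos (fun u => quintic u z) (fun u => quintic_x u z)); auto.
intros; apply is_derive_quintic.
Qed.

Lemma quintic_lt_of_neg z x y : x < y ->
  (forall u, x < u < y -> quintic_x u z < 0) -> quintic y z < quintic x z.
Proof.
intros Hxy Hp. apply Ropp_lt_cancel.
apply (lt_of_derive_pos (fun u => - quintic u z) (fun u => - quintic_x u z)); auto.
- intros; apply (is_derive_opp (fun u => quintic u z)), is_derive_quintic.
- intros u Hu. pose proof (Hp u Hu). lra.
Qed.

Lemma quintic_inc1 z x y : small_z z -> x < y -> y <= -2 -> quintic x z < quintic y z.
Proof.
intros Hz Hxy Hy. apply quintic_lt_of_pos; auto.
intros; apply quintic_x_pos1; auto; lra.
Qed.

Lemma quintic_dec1 z x y : small_z z -> -2 <= x -> x < y -> y <= -1 ->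
  quintic y z < quintic x z.
Proof.
intros Hz Hx Hxy Hy. apply quintic_lt_of_neg; auto.
intros; apply quintic_x_neg1; auto; lra.
Qed.

Lemma quintic_inc2 z x y : small_z z -> -1 <= x -> x < y -> y <= 1 / 10 + z ->
  quintic x z < quintic y z.
Proof.
intros Hz Hx Hxy Hy. apply quintic_lt_of_pos; auto.
intros; apply quintic_x_pos2; auto; lra.
Qed.

Lemma quintic_dec2 z x y : small_z z -> 1 / 10 + z <= x -> x < y -> y <= 1 ->
  quintic y z < quintic x z.
Proof.
intros Hz Hx Hxy Hy. apply quintic_lt_of_neg; auto.
intros; apply quintic_x_neg2; auto; lra.
Qed.

Lemma quintic_inc3 z x y : small_z z -> 1 <= x -> x < y -> quintic x z < quintic y z.
Proof.
intros Hz Hx Hxy. apply quintic_lt_of_pos; auto.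
intros; apply quintic_x_pos3; auto; lra.
Qed.

(** An orbit leaving L1 to the right passes above L3. *)
Lemma quintic_fold3_bounds z : small_z z ->
  1 < quintic (1 / 10 + z) z < quintic (-2) z.
Proof.
unfold small_z; intros Hz. rewrite quintic_fold1. unfold quintic.
set (A := (1 / 10 + z + 1) ^ 2). set (B := (1 / 10 + z - 1) ^ 2).
set (C := 3 * (1 / 10 + z) ^ 2 + 2 * (1 / 10 + z) - 13).
assert (1.18 < A < 1.24) by (unfold A; nra).
assert (0.79 < B < 0.83) by (unfold B; nra).
assert (-13 < C < -12) by (unfold C; nra).
assert (0.79 * 2.4 < B * (1 / 10 + z + 19 / 8) < 0.83 * 2.5) by nra.
assert (- 0.1 < 5 / 12 * z * C < 0.1) by nra.
nra.
Qed.

Lemma quintic_at_2 z : small_z z -> quintic (-2) z < quintic 2 z.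
Proof. unfold small_z; intros. rewrite quintic_fold1. unfold quintic. lra. Qed.

Lemma quintic_root z a b y : a < b -> quintic a z < y < quintic b z ->
  exists x, a < x < b /\ quintic x z = y.
Proof.
intros Hab Hy. apply (intermediate_value (fun x => quintic x z)); auto.
intros; apply continuous_quintic.
Qed.

(** ** Shape of the critical manifold over the fold values *)

Lemma quintic_below_fold1 z : small_z z ->
  exists r, 1 < r < 2 /\ quintic r z = quintic (-2) z /\
    forall x, -2 < x < r -> quintic x z < quintic (-2) z.
Proof.
intros Hz. pose proof (quintic_fold3_bounds z Hz) as B3.
pose proof (quintic_at_2 z Hz) as B2. pose proof Hz as Hz'. unfold small_z in Hz'.
destruct (quintic_root z 1 2 (quintic (-2) z)) as [r [Hr E]]; [lra| |].
{ rewrite quintic_fold4, quintic_fold1 in *. lra. }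
exists r. split; [exact Hr|]. split; [exact E|]. intros x Hx.
destruct (Rle_or_lt x (-1)) as [H1|H1].
{ apply quintic_dec1; auto; lra. }
destruct (Rlt_or_le x (1 / 10 + z)) as [H2|H2].
{ apply Rlt_trans with (quintic (1 / 10 + z) z); [apply quintic_inc2; auto; lra|lra]. }
destruct (Rle_or_lt x 1) as [H3|H3].
{ destruct H2 as [H2|H2]; [|subst x; lra].
  apply Rlt_trans with (quintic (1 / 10 + z) z); [apply quintic_dec2; auto; lra|lra]. }
rewrite <- E. apply quintic_inc3; auto; lra.
Qed.

Lemma quintic_below_fold3 z : small_z z ->
  exists r, 1 < r < 2 /\ quintic r z = quintic (1 / 10 + z) z /\
    forall x, 1 / 10 + z < x < r -> quintic x z < quintic (1 / 10 + z) z.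
Proof.
intros Hz. pose proof (quintic_fold3_bounds z Hz) as B3.
pose proof (quintic_at_2 z Hz) as B2. pose proof Hz as Hz'. unfold small_z in Hz'.
destruct (quintic_root z 1 2 (quintic (1 / 10 + z) z)) as [r [Hr E]]; [lra| |].
{ rewrite quintic_fold4. lra. }
exists r. split; [exact Hr|]. split; [exact E|]. intros x Hx.
destruct (Rle_or_lt x 1) as [H3|H3].
{ apply quintic_dec2; auto; lra. }
rewrite <- E. apply quintic_inc3; auto; lra.
Qed.

Lemma quintic_root_left z y : small_z z -> -1 < y < 1 ->
  exists r, -3 < r < - (9 / 4) /\ quintic r z = y.
Proof.
unfold small_z; intros Hz Hy. apply quintic_root; [lra|].
split; unfold quintic; lra.
Qed.

Lemma quintic_above_fold2 z : small_z z ->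
  exists r, -3 < r < - (9 / 4) /\ quintic r z = quintic (-1) z /\
    forall x, r < x < -1 -> quintic (-1) z < quintic x z.
Proof.
intros Hz. destruct (quintic_root_left z (quintic (-1) z) Hz) as [r [Hr E]].
{ rewrite quintic_fold2; lra. }
exists r. split; [exact Hr|]. split; [exact E|]. intros x Hx.
destruct (Rle_or_lt x (-2)) as [H1|H1].
- rewrite <- E. apply quintic_inc1; auto; lra.
- apply quintic_dec1; auto; lra.
Qed.

(** On its way to the left from L4 the layer flow is stopped in the well around
    x = -1 exactly when the bottom of that well, at height 0, is not above the
    height 40 z / 3 of L4. *)
Lemma quintic_above_fold4 z : small_z z ->
  exists r, -3 < r < - (1 / 2) /\ quintic r z = quintic 1 z /\
    (forall x, r < x < 1 -> quintic 1 z < quintic x z) /\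
    (z < 0 -> r < - (9 / 4)) /\ (z = 0 -> r = -1) /\ (0 < z -> -1 < r).
Proof.
intros Hz. pose proof Hz as Hz'. unfold small_z in Hz'.
pose proof (quintic_fold4 z) as E4. pose proof (quintic_fold2 z) as E2.
assert (R1 : forall x, 1 / 10 + z <= x < 1 -> quintic 1 z < quintic x z).
{ intros; apply quintic_dec2; auto; lra. }
destruct (Rtotal_order z 0) as [Hn|[H0|Hp]].
- destruct (quintic_root_left z (quintic 1 z) Hz) as [r [Hr E]]; [lra|].
  exists r. repeat split; try lra. intros x Hx.
  destruct (Rle_or_lt x (-2)) as [H1|H1].
  { rewrite <- E. apply quintic_inc1; auto; lra. }
  destruct (Rlt_or_le x (-1)) as [H2|[H2|<-]]; [| |lra].
  { apply Rlt_trans with (quintic (-1) z); [lra|apply quintic_dec1; auto; lra]. }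
  destruct (Rlt_or_le x (1 / 10 + z)) as [H3|H3]; [|apply R1; lra].
  apply Rle_lt_trans with (quintic (-1) z); [lra|apply quintic_inc2; auto; lra].
- exists (-1). repeat split; try lra. intros x Hx.
  destruct (Rlt_or_le x (1 / 10 + z)) as [H3|H3]; [|apply R1; lra].
  apply Rle_lt_trans with (quintic (-1) z); [lra|apply quintic_inc2; auto; lra].
- destruct (quintic_root z (-1) (- (1 / 2)) (quintic 1 z)) as [r [Hr E]]; [lra| |].
  { split; [lra|]. rewrite E4. unfold quintic. lra. }
  exists r. repeat split; try lra. intros x Hx.
  destruct (Rlt_or_le x (1 / 10 + z)) as [H3|H3]; [|apply R1; lra].
  rewrite <- E. apply quintic_inc2; auto; lra.
Qed.

Lemma quintic_lipschitz z x y : small_z z -> -3 <= x -> x <= y -> y <= 3 ->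
  Rabs (quintic y z - quintic x z) <= 2000 * (y - x).
Proof.
unfold small_z; intros Hz Hx Hxy Hy.
assert (B : forall u, x <= u <= y -> -2000 <= quintic_x u z <= 2000).
{ intros u Hu. apply Rabs_le_between. unfold quintic_x. rewrite !Rabs_mult.
  rewrite (Rabs_pos_eq 5) by lra.
  assert (Rabs (u - 1) <= 4) by (apply Rabs_le; lra).
  assert (Rabs (u + 1) <= 4) by (apply Rabs_le; lra).
  assert (Rabs (u + 2) <= 5) by (apply Rabs_le; lra).
  assert (Rabs (u - (1 / 10 + z)) <= 4) by (apply Rabs_le; lra).
  replace 2000 with (5 * (4 * 4 * 5 * 5)) by ring.
  apply Rmult_le_compat_l; [lra|].
  do 3 (apply Rmult_le_compat;
        [repeat apply Rmult_le_pos; apply Rabs_pos|apply Rabs_pos| |lra]).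
  lra. }
pose proof (le_of_derive_nonneg (fun u => 2000 * u - quintic u z)
  (fun u => 2000 - quintic_x u z) x y Hxy) as A1.
pose proof (le_of_derive_nonneg (fun u => 2000 * u + quintic u z)
  (fun u => 2000 + quintic_x u z) x y Hxy) as A2.
assert (D : forall u, is_derive (fun u => 2000 * u) u 2000).
{ intros u. auto_derive; [exact I|ring]. }
cbv beta in A1, A2. apply Rabs_le. split.
- assert (2000 * x + quintic x z <= 2000 * y + quintic y z); [|lra].
  apply A2; [|intros u Hu; pose proof (B u Hu); lra].
  intros u _. apply (is_derive_plus (fun u => 2000 * u) (fun u => quintic u z));
  [apply D|apply is_derive_quintic].
- assert (2000 * x - quintic x z <= 2000 * y - quintic y z); [|lra].
  apply A1; [|intros u Hu; pose proof (B u Hu); lra].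
  intros u _. apply (is_derive_minus (fun u => 2000 * u) (fun u => quintic u z));
  [apply D|apply is_derive_quintic].
Qed.


Lemma flat_denominator_pos u : 0 < flat 0 u + flat 0 (1 - u).
Proof.
pose proof (flat_nonneg 0 u). pose proof (flat_nonneg 0 (1 - u)).
destruct (Rlt_or_le 0 u) as [H1|H1].
- pose proof (flat_pos 0 u H1). lra.
- assert (0 < flat 0 (1 - u)) by (apply flat_pos; lra). lra.
Qed.

Lemma drift_left x : x <= 1 / 2 -> drift x = 1.
Proof.
intros Hx. unfold drift, step. rewrite (flat_zero 0 (4 * x - 2)) by lra.
unfold Rdiv. ring.
Qed.

Lemma drift_right x : 3 / 4 <= x -> drift x = -1.
Proof.
intros Hx. pose proof (flat_denominator_pos (4 * x - 2)) as P.
unfold drift, step. rewrite (flat_zero 0 (1 - (4 * x - 2))) in * by lra.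
field. lra.
Qed.

Lemma bump_outside a b x : x <= a \/ b <= x -> bump a b x = 0.
Proof.
intros [H|H]; unfold bump;
[rewrite (flat_zero 0 (x - a)) by lra|rewrite (flat_zero 0 (b - x)) by lra]; ring.
Qed.

Lemma bump_inside a b x : a < x < b -> 0 < bump a b x.
Proof. intros H. apply Rmult_lt_0_compat; apply flat_pos; lra. Qed.

Lemma bump_nonneg a b x : 0 <= bump a b x.
Proof. apply Rmult_le_pos; apply flat_nonneg. Qed.

Lemma twist_localized c1 c2 : localized (twist c1 c2).
Proof.
intros x Hx. unfold inactive in Hx. unfold twist.
rewrite !bump_outside by lra. ring.
Qed.

(** ** Smoothness of the model *)

Lemma Ck_on_drift {V : NormedModule R_AbsRing} (U : V -> Prop) k (h : V -> R) :
  Ck_on U k h -> Ck_on U k (fun p => drift (h p)).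
Proof.
intros Sh.
assert (S4 : Ck_on U k (fun p => 4 * h p - 2)).
{ apply Ck_on_minus; [|apply Ck_on_const].
  apply Ck_on_mult; [apply Ck_on_const|exact Sh]. }
assert (S1 : Ck_on U k (fun p => flat 0 (4 * h p - 2))) by now apply Ck_on_flat.
assert (S2 : Ck_on U k (fun p => flat 0 (1 - (4 * h p - 2)))).
{ apply Ck_on_flat, Ck_on_minus; [apply Ck_on_const|exact S4]. }
unfold drift, step. apply Ck_on_minus; [apply Ck_on_const|].
apply Ck_on_mult; [apply Ck_on_const|].
apply Ck_on_mult; [exact S1|].
apply Ck_on_inv; [|now apply Ck_on_plus].
intros p _. pose proof (flat_denominator_pos (4 * h p - 2)). lra.
Qed.

Lemma Ck_on_bump {V : NormedModule R_AbsRing} (U : V -> Prop) k (h : V -> R) a b :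
  Ck_on U k h -> Ck_on U k (fun p => bump a b (h p)).
Proof.
intros Sh. unfold bump.
apply Ck_on_mult; apply Ck_on_flat; apply Ck_on_minus; auto using Ck_on_const.
Qed.

Lemma Ck_on_twist {V : NormedModule R_AbsRing} (U : V -> Prop) k (h : V -> R) c1 c2 :
  Ck_on U k h -> Ck_on U k (fun p => twist c1 c2 (h p)).
Proof.
intros Sh. unfold twist.
apply Ck_on_plus; (apply Ck_on_mult; [apply Ck_on_const|now apply Ck_on_bump]).
Qed.

Lemma continuous_twist c1 c2 x : continuous (twist c1 c2) x.
Proof.
apply (Ck_on_twist (fun _ : R => True) 0 (fun x : R => x) c1 c2); [|exact I].
intros p _. apply continuous_id.
Qed.

Lemma continuous_bump a b x : continuous (bump a b) x.
Proof.
apply (Ck_on_bump (fun _ : R => True) 0 (fun x : R => x) a b); [|exact I].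
intros p _. apply continuous_id.
Qed.

Lemma is_linear_fst_comp {U V W : NormedModule R_AbsRing} (L : U -> V * W) :
  is_linear L -> is_linear (fun p => fst (L p)).
Proof. intros H. exact (is_linear_comp L fst H is_linear_fst). Qed.

Lemma is_linear_snd_comp {U V W : NormedModule R_AbsRing} (L : U -> V * W) :
  is_linear L -> is_linear (fun p => snd (L p)).
Proof. intros H. exact (is_linear_comp L snd H is_linear_snd). Qed.

Ltac coordinate :=
  apply Ck_on_linear;
  repeat first [apply is_linear_fst | apply is_linear_snd
               |apply is_linear_fst_comp | apply is_linear_snd_comp].

Lemma smooth5_of_x (w : R -> R) :
  (forall k, Ck_on (fun _ : R * R * R * R * R => True) k
     (fun p => w (fst (fst (fst (fst p)))))) ->
  smooth5 (fun x _ _ _ _ => w x).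
Proof.
intros H k. apply Ck_on_ext with (2 := H k).
intros [[[[a b] c] d] e]; reflexivity.
Qed.

Lemma smooth5_twist c1 c2 : smooth5 (fun x _ _ _ _ => twist c1 c2 x).
Proof.
apply smooth5_of_x. intros k.
apply (Ck_on_twist _ k (fun p : R * R * R * R * R => fst (fst (fst (fst p))))).
coordinate.
Qed.

Lemma model_smooth k1 k2 h1 h2 : smooth_system (model (twist k1 k2) (twist h1 h2)).
Proof.
split; [|split].
- intros k. apply Ck_on_ext with
    (fun p : R * R * R * R => quintic (fst (fst (fst p))) (snd (fst (fst p)))).
  { intros [[[a b] c] d]; reflexivity. }
  assert (Sx : Ck_on (fun _ => True) k (fun p : R * R * R * R => fst (fst (fst p))))
    by coordinate.
  assert (Sz : Ck_on (fun _ => True) k (fun p : R * R * R * R => snd (fst (fst p))))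
    by coordinate.
  unfold quintic.
  repeat first [apply Ck_on_minus | apply Ck_on_plus | apply Ck_on_mult
               |apply Ck_on_pow | assumption | apply Ck_on_const].
- apply (smooth5_of_x drift). intros k.
  apply (Ck_on_drift _ k (fun p : R * R * R * R * R => fst (fst (fst (fst p))))).
  coordinate.
- intros k. apply Ck_on_ext with
    (fun p : R * R * R * R * R => snd p * twist k1 k2 (fst (fst (fst (fst p))))
                 + snd (fst (fst p)) * twist h1 h2 (fst (fst (fst (fst p))))).
  { intros [[[[a b] c] d] e]; reflexivity. }
  assert (Sx : Ck_on (fun _ => True) k
     (fun p : R * R * R * R * R => fst (fst (fst (fst p))))) by coordinate.
  apply Ck_on_plus; (apply Ck_on_mult; [coordinate|now apply Ck_on_twist]).
Qed.

(** ** Derivatives and orbits of the model *)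

Lemma model_f_x k h delta x y z : f_x (model k h) delta x y z = - quintic_x x z.
Proof.
apply is_derive_unique. unfold Defs.f; simpl.
rewrite <- (Rminus_0_l (quintic_x x z)).
apply (is_derive_minus (fun _ => y) (fun u => quintic u z)).
- apply @is_derive_const.
- apply is_derive_quintic.
Qed.

Lemma model_f_y k h delta x y z : f_y (model k h) delta x y z = 1.
Proof.
apply is_derive_unique. unfold Defs.f; simpl. auto_derive; [exact I|ring].
Qed.

Lemma model_F_x k h x z : F_x (model k h) x z = quintic_x x z.
Proof. apply is_derive_unique, is_derive_quintic. Qed.

Lemma model_f_xx k h delta x y z :
  f_xx (model k h) delta x y z =
  - 5 * ((x + 1) * (x + 2) * (x - (1 / 10 + z))
         + (x - 1) * (x + 2) * (x - (1 / 10 + z))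
         + (x - 1) * (x + 1) * (x - (1 / 10 + z))
         + (x - 1) * (x + 1) * (x + 2)).
Proof.
unfold f_xx. simpl Derive_n.
rewrite (Derive_ext (fun u => Derive _ u) (fun u => - quintic_x u z)).
2:{ intros u. exact (model_f_x k h delta u y z). }
apply is_derive_unique. unfold quintic_x. auto_derive; [exact I|]. ring.
Qed.

Lemma model_g2_inactive k h x y z eps delta :
  localized k -> localized h -> inactive x -> g2 (model k h) x y z eps delta = 0.
Proof. intros Hk Hh Hx. simpl. rewrite Hk, Hh by exact Hx. ring. Qed.

Lemma model_switching k h delta x y z :
  g2 (model k h) x y z 0 delta = 0 -> switching (model k h) delta x y z = drift x.
Proof.
intros E. unfold switching. rewrite E, model_f_y. simpl. ring.
Qed.

Lemma model_reduced_xdot k h delta x y z :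
  g2 (model k h) x y z 0 delta = 0 ->
  reduced_xdot (model k h) delta x y z = drift x / quintic_x x z.
Proof.
intros E. unfold reduced_xdot. rewrite (model_switching _ _ _ _ _ _ E), model_f_x.
unfold Rdiv. rewrite Rinv_opp. ring.
Qed.

Lemma layer_orbit_right k h delta y z a b x0 :
  small_z z -> -3 <= a -> b <= 3 -> a < x0 < b ->
  quintic a z = y -> quintic b z = y ->
  (forall x, a < x < b -> quintic x z < y) ->
  exists phi, phi 0 = x0 /\ (forall t, a < phi t < b) /\
    layer_connection (model k h) delta y z a b phi.
Proof.
intros Hz Ha Hb Hx0 Ea Eb Hlt.
destruct (increasing_orbit (fun x => y - quintic x z) a b 2000 x0)
  as [phi [P0 [Pin [_ [Pd [Pm Pp]]]]]]; try lra; auto.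
- intros x _. apply (continuous_minus (fun _ => y) (fun u => quintic u z)).
  + apply continuous_const.
  + apply continuous_quintic.
- intros x Hx. pose proof (Hlt x Hx). lra.
- intros x Hx. rewrite <- Ea.
  pose proof (quintic_lipschitz z a x Hz) as L. apply Rabs_le_between in L; lra.
- intros x Hx. rewrite <- Eb.
  pose proof (quintic_lipschitz z x b Hz) as L. apply Rabs_le_between in L; lra.
- exists phi. split; [exact P0|]. split; [exact Pin|]. split; [exact Pd|auto].
Qed.

Lemma layer_orbit_left k h delta y z a b x0 :
  small_z z -> -3 <= a -> b <= 3 -> a < x0 < b ->
  quintic a z = y -> quintic b z = y ->
  (forall x, a < x < b -> y < quintic x z) ->
  exists phi, phi 0 = x0 /\ (forall t, a < phi t < b) /\
    layer_connection (model k h) delta y z b a phi.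
Proof.
intros Hz Ha Hb Hx0 Ea Eb Hlt.
destruct (decreasing_orbit (fun x => y - quintic x z) a b 2000 x0)
  as [phi [P0 [Pin [_ [Pd [Pm Pp]]]]]]; try lra; auto.
- intros x _. apply (continuous_minus (fun _ => y) (fun u => quintic u z)).
  + apply continuous_const.
  + apply continuous_quintic.
- intros x Hx. pose proof (Hlt x Hx). lra.
- intros x Hx. rewrite <- Ea.
  pose proof (quintic_lipschitz z a x Hz) as L. apply Rabs_le_between in L; lra.
- intros x Hx. rewrite <- Eb.
  pose proof (quintic_lipschitz z x b Hz) as L. apply Rabs_le_between in L; lra.
- exists phi. split; [exact P0|]. split; [exact Pin|]. split; [exact Pd|auto].
Qed.

Lemma continuous_nonexpansive (h : R -> R) (x : R) :
  (forall u v, Rabs (h u - h v) <= Rabs (u - v)) -> continuous h x.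
Proof.
intros Hh. apply continuity_pt_filterlim. intros eps Heps.
exists eps. split; [exact Heps|]. intros u [_ Hu].
apply Rle_lt_trans with (2 := Hu). apply Hh.
Qed.

(** Beyond [x0] the vector field is replaced by one with a zero at [x0 + 1];
    the orbit starting at [x0] never sees the change in forward time. *)
Lemma layer_half_orbit_left k h delta y z a x0 :
  small_z z -> -3 <= a -> x0 <= 3 -> a < x0 ->
  quintic a z = y -> (forall x, a < x <= x0 -> y < quintic x z) ->
  exists phi, phi 0 = x0 /\
    (forall t, 0 <= t -> layer_ode_at (model k h) delta y z phi t) /\
    is_lim phi p_infty a.
Proof.
intros Hz Ha Hx0 Hax Ea Hlt.
set (g := fun x => (y - quintic (Rmin x x0) z) * (x0 + 1 - Rmax x x0)).
assert (B : forall x, a < x < x0 + 1 ->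
  (x <= x0 /\ g x = y - quintic x z /\ a < Rmin x x0 <= x0) \/
  (x0 < x /\ g x = (y - quintic x0 z) * (x0 + 1 - x))).
{ intros x Hx. unfold g. destruct (Rle_or_lt x x0) as [L|L].
  - left. rewrite Rmin_left, Rmax_right by lra. split; [lra|split; [ring|lra]].
  - right. rewrite Rmin_right, Rmax_left by lra. split; [lra|ring]. }
assert (L : forall x, a < x <= x0 -> 0 < quintic x z - y <= 2000 * (x - a)).
{ intros x Hx. pose proof (Hlt x Hx). split; [lra|].
  pose proof (quintic_lipschitz z a x Hz) as L. apply Rabs_le_between in L; lra. }
pose proof (L x0) as L0.
(* 12000 = 2000 * 6: to the left of x0, the distance to a is at most 6 and
   the distance to x0 + 1 at least 1. *)
destruct (decreasing_orbit g a (x0 + 1) 12000 x0)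
  as [phi [P0 [Pin [Pdec [Pd [Pm Pp]]]]]]; try lra.
- intros x _. unfold g.
  apply (continuous_mult (fun u => y - quintic (Rmin u x0) z)
                         (fun u => x0 + 1 - Rmax u x0)).
  + apply (continuous_minus (fun _ => y) (fun u => quintic (Rmin u x0) z)).
    { apply continuous_const. }
    apply (continuous_comp (fun u => Rmin u x0) (fun u => quintic u z)).
    2: apply continuous_quintic.
    apply continuous_nonexpansive. intros u v. unfold Rmin.
    destruct (Rle_dec u x0); destruct (Rle_dec v x0); split_Rabs; lra.
  + apply (continuous_minus (fun _ => x0 + 1) (fun u => Rmax u x0)).
    { apply continuous_const. }
    apply continuous_nonexpansive. intros u v. unfold Rmax.
    destruct (Rle_dec u x0); destruct (Rle_dec v x0); split_Rabs; lra.
- intros x Hx. destruct (B x Hx) as [[H1 [-> _]]|[H1 ->]].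
  + pose proof (L x). lra.
  + nra.
- intros x Hx. destruct (B x Hx) as [[H1 [-> _]]|[H1 ->]].
  + pose proof (L x). lra.
  + nra.
- intros x Hx. destruct (B x Hx) as [[H1 [-> _]]|[H1 ->]].
  + pose proof (L x). lra.
  + nra.
- exists phi. split; [exact P0|]. split; [|exact Pp].
  intros t Ht. unfold layer_ode_at, Defs.f; simpl.
  pose proof (Pdec 0 t Ht) as Hle. rewrite P0 in Hle.
  pose proof (Pd t) as D. destruct (B (phi t) (Pin t)) as [[_ [E _]]|[H1 _]]; [|lra].
  rewrite <- E. exact D.
Qed.


(** * The geometric assumptions *)

Lemma model_critical k h delta x y z :
  critical (model k h) model_geometry delta x y z <-> small_z z /\ y = quintic x z.
Proof.
unfold critical, Defs.f, in_range, small_z; simpl.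
split; intros [H1 H2]; split; auto; lra.
Qed.

Lemma model_fold_y k h delta i z :
  fold_y (model k h) model_geometry delta i z = quintic (folds i z) z.
Proof. reflexivity. Qed.

Lemma model_assumption1 k h : assumption1 (model k h) model_geometry.
Proof.
split; [simpl; lra|]. split; [simpl; lra|]. split.
{ intros i n. apply Ck_on_ext with (fun p : R * R => folds i (fst p)).
  { intros [a b]; reflexivity. }
  destruct i; simpl folds;
  first [apply Ck_on_const | apply Ck_on_plus; [apply Ck_on_const|coordinate]]. }
intros delta _. split.
{ intros z Hz. unfold in_range in Hz; simpl in *. lra. }
split.
{ intros x y z. split.
  - intros HC. pose proof HC as HC'. rewrite model_critical in HC'.
    destruct HC' as [Hz _]. unfold small_z in Hz.
    unfold on_sheet, on_fold; simpl.
    destruct (Rtotal_order x (-2)) as [H1|[H1|H1]];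
      [left; now exists Sa1|right; now exists L1|].
    destruct (Rtotal_order x (-1)) as [H2|[H2|H2]];
      [left; now exists Sr1|right; now exists L2|].
    destruct (Rtotal_order x (1 / 10 + z)) as [H3|[H3|H3]];
      [left; now exists Sa2|right; now exists L3|].
    destruct (Rtotal_order x 1) as [H4|[H4|H4]];
      [left; now exists Sr2|right; now exists L4|left; now exists Sa3].
  - intros [[j [HC _]]|[i [HC _]]]; exact HC. }
assert (Zero : forall i z, quintic_x (folds i z) z = 0).
{ intros [] z; unfold quintic_x; simpl; ring. }
assert (Sgn : forall x z, small_z z ->
  (0 < quintic_x x z /\ (x < -2 \/ -1 < x < 1 / 10 + z \/ 1 < x)) \/
  (quintic_x x z <= 0 /\ (x = -2 \/ x = -1 \/ x = 1 / 10 + z \/ x = 1)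
    /\ quintic_x x z = 0) \/
  (quintic_x x z < 0 /\ (-2 < x < -1 \/ 1 / 10 + z < x < 1))).
{ intros x z Hz. pose proof Hz as Hz'. unfold small_z in Hz'.
  destruct (Rtotal_order x (-2)) as [H1|[H1|H1]].
  { left. split; [now apply quintic_x_pos1|lra]. }
  { right; left. rewrite H1. pose proof (Zero L1 z). simpl in H. lra. }
  destruct (Rtotal_order x (-1)) as [H2|[H2|H2]].
  { right; right. split; [now apply quintic_x_neg1|lra]. }
  { right; left. rewrite H2. pose proof (Zero L2 z). simpl in H. lra. }
  destruct (Rtotal_order x (1 / 10 + z)) as [H3|[H3|H3]].
  { left. split; [now apply quintic_x_pos2|lra]. }
  { right; left. rewrite H3. pose proof (Zero L3 z). simpl in H. lra. }
  destruct (Rtotal_order x 1) as [H4|[H4|H4]].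
  { right; right. split; [now apply quintic_x_neg2|lra]. }
  { right; left. rewrite H4. pose proof (Zero L4 z). simpl in H. lra. }
  left. split; [now apply quintic_x_pos3|lra]. }
split.
{ intros x y z. rewrite model_f_x. unfold on_sheet; simpl. split.
  - intros H. assert (HC : critical (model k h) model_geometry delta x y z) by tauto.
    split; [exact HC|]. apply model_critical in HC. destruct HC as [Hz _].
    pose proof (Sgn x z Hz). unfold small_z in Hz. lra.
  - intros [HC H]. pose proof HC as HC'. apply model_critical in HC'.
    destruct HC' as [Hz _]. pose proof (Sgn x z Hz). unfold small_z in Hz.
    assert (x < -2 \/ -1 < x < 1 / 10 + z \/ 1 < x) by lra. tauto. }
split.
{ intros x y z. rewrite model_f_x. unfold on_sheet; simpl. split.
  - intros H. assert (HC : critical (model k h) model_geometry delta x y z) by tauto.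
    split; [exact HC|]. apply model_critical in HC. destruct HC as [Hz _].
    pose proof (Sgn x z Hz). unfold small_z in Hz. lra.
  - intros [HC H]. pose proof HC as HC'. apply model_critical in HC'.
    destruct HC' as [Hz _]. pose proof (Sgn x z Hz). unfold small_z in Hz.
    assert (-2 < x < -1 \/ 1 / 10 + z < x < 1) by lra. tauto. }
intros i x y z [HC E]. simpl in E. apply model_critical in HC.
destruct HC as [Hz _]. rewrite model_f_x, model_f_xx, E, Zero.
split; [ring|]. unfold small_z in Hz. clear E. destruct i; simpl; nra.
Qed.

Lemma folds_inactive i z : small_z z -> inactive (folds i z).
Proof. unfold small_z, inactive; destruct i; simpl; lra. Qed.

(** Near a fold g2 vanishes, so the reduced velocity is drift / F_x; since F_x
    has a simple zero at the fold, with cofactor Q, the product with the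
    distance to the fold has the sign of drift * Q. *)
Lemma model_directed k h delta i (Q : R -> R -> R) :
  localized k -> localized h ->
  (forall x z, quintic_x x z = (x - folds i z) * Q x z) ->
  (forall zf x z, small_z zf -> small_z z -> Rabs (x - folds i zf) < 1 / 100 ->
     inactive x /\ drift x * Q x z < 0) ->
  directed_towards_fold (model k h) model_geometry delta i.
Proof.
intros Hk Hh HQ Hs zf Hf. exists (1 / 100). split; [lra|]. intros x y z HC _ Hx Hn.
apply model_critical in HC. destruct HC as [Hz _]. simpl in Hx, Hn |- *.
destruct (Hs zf x z Hf Hz Hx) as [Hi HdQ].
assert (E : g2 (model k h) x y z 0 delta = 0) by now apply model_g2_inactive.
rewrite (model_reduced_xdot _ _ _ _ _ _ E). simpl in E. rewrite E, HQ.
assert (Q x z <> 0) by (intros E0; rewrite E0 in HdQ; lra).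
assert (0 < / Q x z * / Q x z).
{ apply Rsqr_pos_lt. now apply Rinv_neq_0_compat. }
replace (_ * _) with ((drift x * Q x z) * (/ Q x z * / Q x z)); [nra|].
field. split; [assumption|lra].
Qed.

Lemma model_assumption2 k h : localized k -> localized h ->
  assumption2 (model k h) model_geometry.
Proof.
intros Hk Hh delta _. split; [|split; [|split]].
- intros i x y z [HC E]. simpl in E. apply model_critical in HC.
  destruct HC as [Hz _]. rewrite model_switching.
  + unfold small_z in Hz. rewrite E.
    destruct i; simpl; [rewrite drift_left|rewrite drift_left
                       |rewrite drift_left|rewrite drift_right]; lra.
  + apply model_g2_inactive; auto. rewrite E. now apply folds_inactive.
- apply model_directed with
    (fun x z => - (5 * ((1 - x) * (-1 - x) * (1 / 10 + z - x)))); auto.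
  { intros x z. unfold quintic_x; simpl. ring. }
  unfold small_z; simpl. intros zf x z Hf Hz Hx. apply Rabs_def2 in Hx.
  split; [unfold inactive; lra|]. rewrite drift_left, Rmult_1_l by lra.
  apply Ropp_lt_gt_0_contravar. repeat apply Rmult_lt_0_compat; lra.
- apply model_directed with (fun x z => - (5 * ((1 - x) * (x + 1) * (x + 2)))); auto.
  { intros x z. unfold quintic_x; simpl. ring. }
  unfold small_z; simpl. intros zf x z Hf Hz Hx. apply Rabs_def2 in Hx.
  split; [unfold inactive; lra|]. rewrite drift_left, Rmult_1_l by lra.
  apply Ropp_lt_gt_0_contravar. repeat apply Rmult_lt_0_compat; lra.
- apply model_directed with
    (fun x z => 5 * ((x + 1) * (x + 2) * (x - (1 / 10 + z)))); auto.
  { intros x z. unfold quintic_x; simpl. ring. }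
  unfold small_z; simpl. intros zf x z Hf Hz Hx. apply Rabs_def2 in Hx.
  split; [unfold inactive; lra|]. rewrite drift_right by lra.
  assert (0 < 5 * ((x + 1) * (x + 2) * (x - (1 / 10 + z)))); [|lra].
  repeat apply Rmult_lt_0_compat; lra.
Qed.

Lemma jump_from_fold1 k h delta z : small_z z ->
  exists r phi, 1 < r < 2 /\ quintic r z = quintic (-2) z /\
    (forall t, -2 < phi t < r) /\
    layer_connection (model k h) delta (quintic (-2) z) z (-2) r phi.
Proof.
intros Hz. destruct (quintic_below_fold1 z Hz) as [r [Hr [E Hlt]]].
destruct (layer_orbit_right k h delta (quintic (-2) z) z (-2) r 0)
  as [phi [_ [Pin Pc]]]; auto; try lra.
exists r, phi; auto.
Qed.

Lemma jump_from_fold3 k h delta z : small_z z ->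
  exists r phi, 1 < r < 2 /\ quintic r z = quintic (1 / 10 + z) z /\
    (forall t, 1 / 10 + z < phi t < r) /\
    layer_connection (model k h) delta (quintic (1 / 10 + z) z) z (1 / 10 + z) r phi.
Proof.
intros Hz. pose proof Hz as Hz'. unfold small_z in Hz'.
destruct (quintic_below_fold3 z Hz) as [r [Hr [E Hlt]]].
destruct (layer_orbit_right k h delta (quintic (1 / 10 + z) z) z (1 / 10 + z) r 1)
  as [phi [_ [Pin Pc]]]; auto; try lra.
exists r, phi; auto.
Qed.

Lemma jump_from_fold2 k h delta z : small_z z ->
  exists r phi, -3 < r < - (9 / 4) /\ quintic r z = quintic (-1) z /\
    (forall t, r < phi t < -1) /\
    layer_connection (model k h) delta (quintic (-1) z) z (-1) r phi.
Proof.
intros Hz. destruct (quintic_above_fold2 z Hz) as [r [Hr [E Hlt]]].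
destruct (layer_orbit_left k h delta (quintic (-1) z) z r (-1) (-2))
  as [phi [_ [Pin Pc]]]; auto; try lra.
exists r, phi; auto.
Qed.

Lemma jump_from_fold4 k h delta z : small_z z ->
  exists r phi, -3 < r < - (1 / 2) /\ quintic r z = quintic 1 z /\
    (z < 0 -> r < - (9 / 4)) /\ (z = 0 -> r = -1) /\ (0 < z -> -1 < r) /\
    phi 0 = 0 /\ (forall t, r < phi t < 1) /\
    layer_connection (model k h) delta (quintic 1 z) z 1 r phi.
Proof.
intros Hz. destruct (quintic_above_fold4 z Hz) as [r [Hr [E [Hlt [Hn [H0 Hp]]]]]].
destruct (layer_orbit_left k h delta (quintic 1 z) z r 1 0)
  as [phi [P0 [Pin Pc]]]; auto; try lra.
exists r, phi; auto 9.
Qed.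

Lemma model_projects k h i j x z :
  small_z z -> quintic x z = quintic (folds i z) z ->
  on_sheet (model k h) model_geometry 0 j x (quintic x z) z ->
  layer_path (model k h) 0 (quintic (folds i z) z) z (folds i z) x ->
  projects_onto (model k h) model_geometry 0 i j z.
Proof.
intros Hz E Hs Hp. exists x, (quintic x z). split; [|exact Hs].
split; [exact Hz|]. split; [exact E|]. rewrite E. exact Hp.
Qed.

(** At z = 0 the way from L4 to S_a1 consists of two heteroclinic orbits, with
    an intermediate equilibrium on L2. *)
Lemma model_projects_fold4_left k h z : small_z z -> z <= 0 ->
  projects_onto (model k h) model_geometry 0 L4 Sa1 z.
Proof.
intros Hz Hle.
destruct (jump_from_fold4 k h 0 z Hz) as [r [phi [Hr [E [Hn [H0 [_ [_ [_ Pc]]]]]]]]].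
destruct Hle as [L|Ez].
- apply (model_projects k h L4 Sa1 r); auto.
  + split; [now apply model_critical|simpl; specialize (Hn L); lra].
  + exact (layer_path_one _ _ _ _ _ _ _ Pc).
- specialize (H0 Ez).
  destruct (jump_from_fold2 k h 0 z Hz) as [r' [psi [Hr' [E' [_ Pc']]]]].
  assert (E'' : quintic (-1) z = quintic 1 z) by now rewrite <- H0.
  apply (model_projects k h L4 Sa1 r'); auto.
  + simpl. now rewrite E'.
  + split; [now apply model_critical|simpl; lra].
  + simpl. apply layer_path_cat with (-1).
    * apply layer_path_one with phi. now rewrite <- H0.
    * apply layer_path_one with psi. now rewrite <- E''.
Qed.

Lemma model_projects_fold4_right k h z : small_z z -> 0 < z ->
  projects_onto (model k h) model_geometry 0 L4 Sa2 z.
Proof.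
intros Hz Hp. pose proof Hz as Hz'. unfold small_z in Hz'.
destruct (jump_from_fold4 k h 0 z Hz) as [r [phi [Hr [E [_ [_ [Hq [_ [_ Pc]]]]]]]]].
apply (model_projects k h L4 Sa2 r); auto.
- split; [now apply model_critical|simpl; specialize (Hq Hp); lra].
- exact (layer_path_one _ _ _ _ _ _ _ Pc).
Qed.

(** Where H vanishes the reduced vector field is parallel to the y-axis, hence
    transverse to every graph over z. *)
Lemma model_transverse k h i j : localized h ->
  (forall x z, small_z z -> on_sheet (model k h) model_geometry 0 j x (quintic x z) z ->
     quintic x z = quintic (folds i z) z -> inactive x /\ drift x <> 0) ->
  reduced_transverse_to_omega (model k h) model_geometry 0 i j.
Proof.
intros Hh H x y z [Hz [Ey _]] Hs.
pose proof (proj1 Hs) as HC. apply model_critical in HC. destruct HC as [_ E].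
rewrite model_fold_y, E in Ey. subst y.
destruct (H x z Hz Hs Ey) as [Hi Hd]. split.
- apply ex_derive_ext with (fun u => quintic (folds i u) u); [reflexivity|].
  unfold quintic. destruct i; simpl folds; auto_derive; exact I.
- unfold transverse2; simpl. rewrite Hh by exact Hi.
  replace (_ - _) with (drift x) by ring. exact Hd.
Qed.

Lemma on_right_sheet_inactive k h x y z :
  on_sheet (model k h) model_geometry 0 Sa3 x y z -> inactive x /\ drift x <> 0.
Proof.
intros [_ Hx]; simpl in Hx. split; [unfold inactive; lra|].
rewrite drift_right; lra.
Qed.

Lemma on_left_sheet_inactive x z : small_z z -> x < -2 -> quintic x z < 1 ->
  inactive x /\ drift x <> 0.
Proof.
intros Hz Hx Hq. split; [|rewrite drift_left; lra].
left. apply Rnot_lt_le. intros Hlt.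
pose proof (quintic_inc1 z (- (9 / 4)) x Hz Hlt (Rlt_le _ _ Hx)) as L.
unfold small_z in Hz. unfold quintic in L at 1. lra.
Qed.

Lemma model_assumption3 k h : localized h -> assumption3 (model k h) model_geometry.
Proof.
intros Hh. split; [|split; [|split; [|split; [|split; [|split; [|split]]]]]].
- intros z Hz. change (small_z z) in Hz. pose proof Hz as Hz'. unfold small_z in Hz'.
  split; [|split; [|split]].
  + destruct (jump_from_fold1 k h 0 z Hz) as [r [phi [Hr [E [_ Pc]]]]].
    apply (model_projects k h L1 Sa3 r); auto.
    * split; [now apply model_critical|simpl; lra].
    * exact (layer_path_one _ _ _ _ _ _ _ Pc).
  + destruct (jump_from_fold3 k h 0 z Hz) as [r [phi [Hr [E [_ Pc]]]]].
    apply (model_projects k h L3 Sa3 r); auto.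
    * split; [now apply model_critical|simpl; lra].
    * exact (layer_path_one _ _ _ _ _ _ _ Pc).
  + destruct (jump_from_fold2 k h 0 z Hz) as [r [phi [Hr [E [_ Pc]]]]].
    apply (model_projects k h L2 Sa1 r); auto.
    * split; [now apply model_critical|simpl; lra].
    * exact (layer_path_one _ _ _ _ _ _ _ Pc).
  + destruct (Rle_or_lt z 0) as [L|L];
    [left; now apply model_projects_fold4_left|right; now apply model_projects_fold4_right].
- exists 0. apply model_projects_fold4_left; unfold small_z; lra.
- exists (1 / 200). apply model_projects_fold4_right; unfold small_z; lra.
- apply model_transverse; auto. intros x z _ Hs _.
  now apply on_right_sheet_inactive in Hs.
- apply model_transverse; auto. intros x z _ Hs _.
  now apply on_right_sheet_inactive in Hs.
- apply model_transverse; auto. intros x z Hz [_ Hx] E; simpl in Hx, E.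
  apply on_left_sheet_inactive with z; auto. rewrite E, quintic_fold2. lra.
- apply model_transverse; auto. intros x z Hz [_ Hx] E; simpl in Hx, E.
  apply on_left_sheet_inactive with z; auto. rewrite E, quintic_fold4.
  unfold small_z in Hz; lra.
- apply model_transverse; auto. intros x z Hz [_ Hx] E; simpl in Hx, E.
  pose proof Hz as Hz'. unfold small_z in Hz'.
  split; [|rewrite drift_left; lra].
  right; left. split; [lra|]. apply Rnot_lt_le. intros Hlt.
  assert (L : quintic (- (1 / 2)) z < quintic x z) by (apply quintic_inc2; auto; lra).
  rewrite E, quintic_fold4 in L. unfold quintic in L. lra.
Qed.

Lemma model_PL4 k h delta y z :
  PL4 (model k h) model_geometry delta y z <-> small_z z /\ y = 40 / 3 * z.
Proof.
unfold PL4. rewrite model_fold_y. simpl folds. rewrite quintic_fold4. split.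
- intros [[Hz _] [E _]]. auto.
- intros [Hz E]. split; [split; [exact Hz|unfold small_z in Hz; lra]|].
  split; [exact E|].
  destruct (jump_from_fold4 k h delta z Hz)
    as [r [phi [_ [_ [_ [_ [_ [P0 [_ [Pd [Pm _]]]]]]]]]]].
  rewrite quintic_fold4, <- E in Pd. exists phi. auto.
Qed.

Lemma model_PL2 k h delta y z :
  PL2 (model k h) model_geometry delta y z <-> small_z z /\ y = 0.
Proof.
unfold PL2. rewrite model_fold_y. simpl folds. rewrite quintic_fold2. split.
- intros [[Hz _] [E _]]. auto.
- intros [Hz E]. split; [split; [exact Hz|lra]|]. split; [exact E|].
  destruct (layer_half_orbit_left k h delta y z (-1) 0) as [phi [P0 [Pd Pl]]];
    auto; try lra.
  + rewrite E. apply quintic_fold2.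
  + intros x Hx. rewrite E, <- (quintic_fold2 z).
    unfold small_z in Hz. apply quintic_inc2; auto; lra.
  + exists phi. auto.
Qed.

Lemma model_section k h : section_ok (model k h) model_geometry.
Proof.
split; [|split; [|split]].
- apply open_ext with (fun p : R * R =>
    ((- (1 / 100) < snd p) /\ (snd p < 1 / 100)) /\ (-1 < fst p /\ fst p < 1)).
  { intros [a b]; simpl. unfold small_z. tauto. }
  assert (O1 : forall c, open (fun p : R * R => c < fst p)).
  { intros c. apply (open_comp (fun p : R * R => fst p) (fun u => c < u)).
    - intros p _. apply continuous_fst.
    - apply open_gt. }
  assert (O2 : forall c, open (fun p : R * R => fst p < c)).
  { intros c. apply (open_comp (fun p : R * R => fst p) (fun u => u < c)).
    - intros p _. apply continuous_fst.
    - apply open_lt. }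
  assert (O3 : forall c, open (fun p : R * R => c < snd p)).
  { intros c. apply (open_comp (fun p : R * R => snd p) (fun u => c < u)).
    - intros p _. apply continuous_snd.
    - apply open_gt. }
  assert (O4 : forall c, open (fun p : R * R => snd p < c)).
  { intros c. apply (open_comp (fun p : R * R => snd p) (fun u => u < c)).
    - intros p _. apply continuous_snd.
    - apply open_lt. }
  repeat apply open_and; auto.
- intros n. apply Ck_on_ext with (fun _ : R * R => 0).
  { intros [a b]; reflexivity. }
  apply (Ck_on_const (V := prod_NormedModule _ R_NormedModule R_NormedModule)).
- intros y z [Hz _]. exact Hz.
- intros delta _. split.
  + intros y z [Hz Hy]. unfold Defs.f; simpl. split; [lra|].
    unfold small_z in Hz. unfold quintic. lra.
  + intros z Hz. exists (40 / 3 * z). apply model_PL4. auto.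
Qed.

Lemma model_assumption4 k h : assumption4 (model k h) model_geometry.
Proof.
split; [exact (is_derive_const (K := R_AbsRing) (V := R_NormedModule) 0 0)|].
intros delta _. split; [unfold in_range; simpl; lra|]. split; [|split].
- exists (fun _ => 0), (fun z => 40 / 3 * z).
  split; [apply model_PL2|]. split; [apply model_PL4|].
  split; [simpl; ring|]. split; [apply ex_derive_const|].
  assert (D : is_derive (fun z => 40 / 3 * z) (z0 model_geometry delta) (40 / 3)).
  { auto_derive; [exact I|ring]. }
  split; [eexists; exact D|].
  unfold transverse2; cbn [fst snd].
  assert (E : Derive (fun z : R => 40 / 3 * z) (z0 model_geometry delta) = 40 / 3)
    by exact (is_derive_unique _ _ _ D).
  rewrite E, Derive_const. lra.
- intros y z HP Hlt. apply model_PL4 in HP. destruct HP as [Hz E]. simpl in Hlt.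
  pose proof Hz as Hz'. unfold small_z in Hz'. split.
  + intros x yS HS. pose proof (quintic_fold2 z) as E2.
    destruct HS as [[HC Hx]|[HC Hx]]; simpl in Hx; apply model_critical in HC;
    destruct HC as [_ ->].
    * assert (quintic (-1) z < quintic x z) by (apply quintic_dec1; auto; lra). lra.
    * assert (quintic (-1) z < quintic x z) by (apply quintic_inc2; auto; lra). lra.
  + destruct (jump_from_fold4 k h delta z Hz)
      as [r [phi [Hr [Er [Hn [_ [_ [P0 [_ [Pd [_ Pp]]]]]]]]]]].
    rewrite quintic_fold4, <- E in Pd, Er.
    exists phi, r. split; [exact P0|]. split; [auto|]. split; [exact Pp|].
    split; [now apply model_critical|]. simpl. specialize (Hn Hlt). lra.
- intros y z HP Hlt. apply model_PL4 in HP. destruct HP as [Hz E]. simpl in Hlt.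
  pose proof Hz as Hz'. unfold small_z in Hz'.
  destruct (jump_from_fold4 k h delta z Hz)
    as [r [phi [Hr [Er [_ [_ [Hq [P0 [_ [Pd [_ Pp]]]]]]]]]]].
  rewrite quintic_fold4, <- E in Pd, Er.
  exists phi, r. split; [exact P0|]. split; [auto|]. split; [exact Pp|].
  split; [now apply model_critical|]. simpl. specialize (Hq Hlt). lra.
Qed.


(** * The singular cycles *)

Lemma model_sheet k h j x : on_sheet (model k h) model_geometry 0 j x (quintic x 0) 0 <->
  match j with
  | Sa1 => x < -2 | Sr1 => -2 < x < -1 | Sa2 => -1 < x < 1 / 10 + 0
  | Sr2 => 1 / 10 + 0 < x < 1 | Sa3 => 1 < x
  end.
Proof.
unfold on_sheet. rewrite model_critical.
assert (small_z 0) by (unfold small_z; lra).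
destruct j; simpl; intuition.
Qed.

(** The attracting sheets all increase with x, but the drift runs through the
    left and middle ones rightwards and through the right-hand one leftwards;
    this allows both cases to be treated at once. *)
Definition traversal (a b c e sigma : R) : Prop :=
  a < b /\ ((c = a /\ e = b /\ sigma = 1) \/ (c = b /\ e = a /\ sigma = -1)).

(** In the plane z = 0 the drift has constant speed sigma along y, so that
    y(tau) is affine and x(tau) is the inverse of the increasing branch of
    the critical manifold; this inverse is continuous also at fold points. *)
Lemma model_reduced_arc k h j a b c e sigma :
  traversal a b c e sigma ->
  (forall x, a < x < b -> on_sheet (model k h) model_geometry 0 j x (quintic x 0) 0) ->
  (forall x, a < x < b -> drift x = sigma) ->
  (forall x, a < x < b -> 0 < quintic_x x 0) ->
  exists C,
    reduced_arc (model k h) model_geometry 0 j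
      (c, quintic c 0, 0) (e, quintic e 0, 0) C /\
    (forall x y z, C x y z -> a <= x <= b /\ z = 0) /\
    (forall x, a < x < b -> C x (quintic x 0) 0).
Proof.
intros [Hab Hce] Hsh Hdr Hpos.
set (q := fun x => quintic x 0).
assert (Qi : forall x y, a <= x -> x < y -> y <= b -> q x < q y).
{ intros x y Hx Hxy Hy. apply quintic_lt_of_pos; auto. intros; apply Hpos; lra. }
assert (Qc : forall x, a <= x <= b -> continuous q x).
{ intros; apply continuous_quintic. }
destruct (increasing_segment_inverse q a b Hab Qc Qi) as [phi [Pc Pq]].
pose proof (Qi a b) as Qab.
assert (P : forall y, q a <= y <= q b ->
  a <= phi y <= b /\ q (phi y) = y /\ (q a < y < q b -> a < phi y < b)).
{ intros y Hy. destruct (Rle_lt_or_eq_dec (q a) y) as [La|<-]; [lra| |].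
  - destruct (Rle_lt_or_eq_dec y (q b)) as [Lb| ->]; [lra| |].
    + destruct (intermediate_value q a b y Hab Qc (conj La Lb)) as [x [Hx <-]].
      rewrite Pq by lra. repeat split; lra.
    + rewrite Pq by lra. repeat split; lra.
  - rewrite Pq by lra. repeat split; lra. }
set (T := q b - q a).
assert (HT : 0 < T) by (unfold T; lra).
assert (In : forall tau, 0 <= tau <= T -> q a <= q c + sigma * tau <= q b).
{ intros tau Ht. unfold T in Ht. destruct Hce as [[-> [_ ->]]|[-> [_ ->]]]; lra. }
assert (In' : forall tau, 0 < tau < T -> q a < q c + sigma * tau < q b).
{ intros tau Ht. unfold T in Ht. destruct Hce as [[-> [_ ->]]|[-> [_ ->]]]; lra. }
assert (Cy : forall tau, continuous (fun tau => q c + sigma * tau) tau).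
{ intros tau. apply (ex_derive_continuous (fun tau => q c + sigma * tau)).
  auto_derive; exact I. }
exists (fun x y z => exists tau, 0 <= tau <= T /\
  x = phi (q c + sigma * tau) /\ y = q c + sigma * tau /\ z = 0).
split; [|split].
- exists T, (fun tau => phi (q c + sigma * tau)), (fun tau => q c + sigma * tau),
    (fun _ => 0).
  split; [exact HT|]. split; [|split; [|split; [|split]]].
  + intros tau _. split; [|split; [apply Cy|apply continuous_const]].
    apply (continuous_comp (fun tau => q c + sigma * tau) phi); [apply Cy|apply Pc].
  + intros tau Ht. pose proof (In' tau Ht) as Hy.
    destruct (P (q c + sigma * tau)) as [_ [E Hx]]; [lra|]. specialize (Hx Hy).
    split; [|split].
    * pose proof (Hsh _ Hx) as S. fold (q (phi (q c + sigma * tau))) in S.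
      now rewrite E in S.
    * simpl. rewrite (Hdr _ Hx). auto_derive; [exact I|ring].
    * simpl. rewrite !Rmult_0_l, Rplus_0_r. apply @is_derive_const.
  + rewrite Rmult_0_r, Rplus_0_r, Pq; [reflexivity|].
    destruct Hce as [[-> _]|[-> _]]; lra.
  + assert (E : q c + sigma * T = q e).
    { unfold T. destruct Hce as [[-> [-> ->]]|[-> [-> ->]]]; ring. }
    rewrite E, Pq; [reflexivity|]. destruct Hce as [[_ [-> _]]|[_ [-> _]]]; lra.
  + intros x y z. reflexivity.
- intros x y z [tau [Ht [-> [_ ->]]]]. split; [|reflexivity]. apply P. now apply In.
- intros x Hx. exists (sigma * (q x - q c)).
  pose proof (Qi a x). pose proof (Qi x b).
  assert (E : q c + sigma * (sigma * (q x - q c)) = q x).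
  { destruct Hce as [[_ [_ ->]]|[_ [_ ->]]]; ring. }
  rewrite E, Pq by lra. split; [|auto].
  unfold T. destruct Hce as [[-> [_ ->]]|[-> [_ ->]]]; lra.
Qed.

Lemma quintic_pos_left x : - (19 / 8) < x < -1 -> 0 < quintic x 0.
Proof.
intros Hx. unfold quintic.
replace (_ * _) with ((- x - 1) ^ 2 * ((1 - x) ^ 2 * (x + 19 / 8))) by ring.
repeat apply Rmult_lt_0_compat; try apply pow_lt; lra.
Qed.

Lemma small_z_0 : small_z 0.
Proof. unfold small_z; lra. Qed.

Lemma arc_fold4_to_fold2 k h : exists C,
  layer_arc (model k h) 0 (fold_pt (model k h) model_geometry 0 L4 0)
    (fold_pt (model k h) model_geometry 0 L2 0) C /\
  (forall x y z, C x y z -> -1 < x < 1 /\ z = 0) /\ C 0 0 0.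
Proof.
destruct (jump_from_fold4 k h 0 0 small_z_0)
  as [r [phi [_ [_ [_ [H0 [_ [P0 [Pin Pc]]]]]]]]].
rewrite (H0 eq_refl) in *.
assert (E4 : quintic 1 0 = 0) by (rewrite quintic_fold4; ring).
exists (fun x y z => (exists t, x = phi t) /\ y = quintic 1 0 /\ z = 0).
split; [|split].
- split; [|split; [reflexivity|]].
  + rewrite !model_fold_y. simpl folds. now rewrite quintic_fold2.
  + exists phi. split; [exact Pc|]. intros; reflexivity.
- intros x y z [[t ->] [_ ->]]. auto.
- rewrite E4. split; [now exists 0|auto].
Qed.

Lemma arc_fold2_to_left k h : exists C,
  layer_arc (model k h) 0 (fold_pt (model k h) model_geometry 0 L2 0)
    (- (19 / 8), quintic (- (19 / 8)) 0, 0) C /\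
  (forall x y z, C x y z -> - (19 / 8) < x < -1 /\ z = 0).
Proof.
assert (E : quintic (- (19 / 8)) 0 = quintic (-1) 0) by (unfold quintic; field).
destruct (layer_orbit_left k h 0 (quintic (-1) 0) 0 (- (19 / 8)) (-1) (-2))
  as [phi [_ [Pin Pc]]]; try lra; auto using small_z_0.
{ intros x Hx. rewrite quintic_fold2. now apply quintic_pos_left. }
exists (fun x y z => (exists t, x = phi t) /\ y = quintic (-1) 0 /\ z = 0).
split.
- split; [now rewrite E|split; [reflexivity|]].
  exists phi. split; [exact Pc|]. intros; reflexivity.
- intros x y z [[t ->] [_ ->]]. auto.
Qed.

Lemma arc_fold1_to_right k h : exists r C, 1 < r /\
  layer_arc (model k h) 0 (fold_pt (model k h) model_geometry 0 L1 0)
    (r, quintic r 0, 0) C /\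
  (forall x y z, C x y z -> -2 < x < r /\ z = 0).
Proof.
destruct (jump_from_fold1 k h 0 0 small_z_0) as [r [phi [Hr [E [Pin Pc]]]]].
exists r, (fun x y z => (exists t, x = phi t) /\ y = quintic (-2) 0 /\ z = 0).
split; [lra|split].
- split; [now rewrite E|split; [reflexivity|]].
  exists phi. split; [exact Pc|]. intros; reflexivity.
- intros x y z [[t ->] [_ ->]]. auto.
Qed.

Lemma arc_fold3_to_right k h : exists r C, 1 < r /\
  layer_arc (model k h) 0 (fold_pt (model k h) model_geometry 0 L3 0)
    (r, quintic r 0, 0) C /\
  (forall x y z, C x y z -> 1 / 10 + 0 < x < r /\ z = 0).
Proof.
destruct (jump_from_fold3 k h 0 0 small_z_0) as [r [phi [Hr [E [Pin Pc]]]]].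
exists r, (fun x y z => (exists t, x = phi t) /\ y = quintic (1 / 10 + 0) 0 /\ z = 0).
split; [lra|split].
- split; [now rewrite E|split; [reflexivity|]].
  exists phi. split; [exact Pc|]. intros; reflexivity.
- intros x y z [[t ->] [_ ->]]. auto.
Qed.

Lemma arc_left k h : exists C,
  reduced_arc (model k h) model_geometry 0 Sa1
    (- (19 / 8), quintic (- (19 / 8)) 0, 0)
    (fold_pt (model k h) model_geometry 0 L1 0) C /\
  (forall x y z, C x y z -> - (19 / 8) <= x <= -2 /\ z = 0) /\
  (forall x, - (19 / 8) < x < -2 -> C x (quintic x 0) 0).
Proof.
apply (model_reduced_arc k h Sa1 (- (19 / 8)) (-2) (- (19 / 8)) (-2) 1).
- split; [lra|auto].
- intros x Hx. apply model_sheet; lra.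
- intros x Hx. apply drift_left; lra.
- intros x Hx. apply quintic_x_pos1; [apply small_z_0|lra].
Qed.

Lemma arc_middle k h : exists C,
  reduced_arc (model k h) model_geometry 0 Sa2
    (fold_pt (model k h) model_geometry 0 L2 0)
    (fold_pt (model k h) model_geometry 0 L3 0) C /\
  (forall x y z, C x y z -> -1 <= x <= 1 / 10 + 0 /\ z = 0) /\
  (forall x, -1 < x < 1 / 10 + 0 -> C x (quintic x 0) 0).
Proof.
apply (model_reduced_arc k h Sa2 (-1) (1 / 10 + 0) (-1) (1 / 10 + 0) 1).
- split; [lra|auto].
- intros x Hx. apply model_sheet; lra.
- intros x Hx. apply drift_left; lra.
- intros x Hx. apply quintic_x_pos2; [apply small_z_0|lra].
Qed.

Lemma arc_right k h r : 1 < r -> exists C,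
  reduced_arc (model k h) model_geometry 0 Sa3
    (r, quintic r 0, 0) (fold_pt (model k h) model_geometry 0 L4 0) C /\
  (forall x y z, C x y z -> 1 <= x <= r /\ z = 0) /\
  (forall x, 1 < x < r -> C x (quintic x 0) 0).
Proof.
intros Hr. apply (model_reduced_arc k h Sa3 1 r r 1 (-1)).
- split; [lra|auto].
- intros x Hx. apply model_sheet; lra.
- intros x Hx. apply drift_right; lra.
- intros x Hx. apply quintic_x_pos3; [apply small_z_0|lra].
Qed.

Lemma Pc_at_origin k h (Gamma : region) :
  Gamma 0 0 0 -> contains_Pc (model k h) model_geometry Gamma.
Proof.
intros H. exists 0, 0, 0. split; [|exact H].
split; [reflexivity|]. split; [|split; [|reflexivity]].
- apply model_PL2. auto using small_z_0.
- apply model_PL4. split; [apply small_z_0|ring].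
Qed.

(** The endpoints are left undetermined: they belong to the sheet or not
    according to whether they are landing points or fold points. *)
Definition follows k h (Gamma : region) (j : sheet) (a b : R) : Prop :=
  (forall x y z, on_part (model k h) model_geometry Gamma j x y z ->
     a <= x <= b /\ z = 0) /\
  (forall x, a < x < b ->
     on_part (model k h) model_geometry Gamma j x (quintic x 0) 0).

Lemma model_GammaL k h : exists Gamma r, 1 < r /\
  is_GammaL (model k h) model_geometry Gamma /\
  contains_Pc (model k h) model_geometry Gamma /\
  (forall x y z, Gamma x y z -> z = 0) /\
  follows k h Gamma Sa1 (- (19 / 8)) (-2) /\ follows k h Gamma Sa3 1 r.
Proof.
destruct (arc_fold4_to_fold2 k h) as [C1 [A1 [B1 O1]]].
destruct (arc_fold2_to_left k h) as [C2 [A2 B2]].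
destruct (arc_left k h) as [C3 [A3 [B3 D3]]].
destruct (arc_fold1_to_right k h) as [r [C4 [Hr [A4 B4]]]].
destruct (arc_right k h r Hr) as [C5 [A5 [B5 D5]]].
exists (fun x y z => C1 x y z \/ C2 x y z \/ C3 x y z \/ C4 x y z \/ C5 x y z), r.
split; [exact Hr|]. split; [|split; [|split; [|split]]].
- exists (- (19 / 8), quintic (- (19 / 8)) 0, 0), (r, quintic r 0, 0), C1, C2, C3, C4, C5.
  split; [exact A1|]. split; [exact A2|]. split; [apply model_sheet; lra|].
  split; [exact A3|]. split; [exact A4|]. split; [apply model_sheet; lra|].
  split; [exact A5|]. intros; reflexivity.
- apply Pc_at_origin. auto.
- intros x y z [H|[H|[H|[H|H]]]];
  [apply B1 in H|apply B2 in H|apply B3 in H|apply B4 in H|apply B5 in H]; tauto.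
- split.
  + intros x y z [H [_ Hx]]; simpl in Hx.
    destruct H as [H|[H|[H|[H|H]]]];
    [apply B1 in H|apply B2 in H|apply B3 in H|apply B4 in H|apply B5 in H];
    split; lra.
  + intros x Hx. split; [auto|apply model_sheet; lra].
- split.
  + intros x y z [H [_ Hx]]; simpl in Hx.
    destruct H as [H|[H|[H|[H|H]]]];
    [apply B1 in H|apply B2 in H|apply B3 in H|apply B4 in H|apply B5 in H];
    split; lra.
  + intros x Hx. split; [auto 6|apply model_sheet; lra].
Qed.

Lemma model_GammaS k h : exists Gamma r, 1 < r /\
  is_GammaS (model k h) model_geometry Gamma /\
  contains_Pc (model k h) model_geometry Gamma /\
  (forall x y z, Gamma x y z -> z = 0) /\
  follows k h Gamma Sa2 (-1) (1 / 10 + 0) /\ follows k h Gamma Sa3 1 r.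
Proof.
destruct (arc_fold4_to_fold2 k h) as [C1 [A1 [B1 O1]]].
destruct (arc_middle k h) as [C2 [A2 [B2 D2]]].
destruct (arc_fold3_to_right k h) as [r [C3 [Hr [A3 B3]]]].
destruct (arc_right k h r Hr) as [C4 [A4 [B4 D4]]].
exists (fun x y z => C1 x y z \/ C2 x y z \/ C3 x y z \/ C4 x y z), r.
split; [exact Hr|]. split; [|split; [|split; [|split]]].
- exists (r, quintic r 0, 0), C1, C2, C3, C4.
  split; [exact A1|]. split; [exact A2|]. split; [exact A3|].
  split; [apply model_sheet; lra|]. split; [exact A4|]. intros; reflexivity.
- apply Pc_at_origin. auto.
- intros x y z [H|[H|[H|H]]];
  [apply B1 in H|apply B2 in H|apply B3 in H|apply B4 in H]; tauto.
- split.
  + intros x y z [H [_ Hx]]; simpl in Hx.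
    destruct H as [H|[H|[H|H]]];
    [apply B1 in H|apply B2 in H|apply B3 in H|apply B4 in H]; split; lra.
  + intros x Hx. split; [auto|apply model_sheet; lra].
- split.
  + intros x y z [H [_ Hx]]; simpl in Hx.
    destruct H as [H|[H|[H|H]]];
    [apply B1 in H|apply B2 in H|apply B3 in H|apply B4 in H]; split; lra.
  + intros x Hx. split; [auto|apply model_sheet; lra].
Qed.

(** * The piecewise affine map of the model *)

Definition of_x (w : R -> R) : R -> R -> R -> R -> R -> R := fun x _ _ _ _ => w x.

Definition plane_curve (c e : R) : xcurve := XCurve c e (fun _ => 0).

(** The factor 1 / g1 disappears, as g1 = 1 on the supports. The lemma serves
    for q as well, since p and q have the same form. *)
Lemma model_p_int k h w c e : localized w ->
  p_int (model k h) (of_x w) (plane_curve c e) = fun x => w x * quintic_x x 0.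
Proof.
intros Hw. apply functional_extensionality. intros x.
unfold p_int, of_x; simpl. rewrite model_F_x.
destruct (Rle_or_lt x (1 / 2)) as [L|L].
- rewrite drift_left by exact L. field.
- rewrite Hw by (unfold inactive; lra). unfold Rdiv. ring.
Qed.

Lemma model_qexp_int k h c e : localized k -> localized h ->
  qexp_int (model k h) (of_x k) (of_x h) (plane_curve c e) =
  fun x => k x * quintic_x x 0 * exp (RInt (fun u => h u * quintic_x u 0) x e).
Proof.
intros Hk Hh. apply functional_extensionality. intros x.
unfold qexp_int. rewrite (model_p_int k h h c e Hh).
change (q_int (model k h) (of_x k) (plane_curve c e) x)
  with (p_int (model k h) (of_x k) (plane_curve c e) x).
now rewrite (model_p_int k h k c e Hk).
Qed.

Lemma continuous_weight w x : continuous w x -> continuous (fun x => w x * quintic_x x 0) x.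
Proof.
intros Hw. apply (continuous_mult w (fun x => quintic_x x 0)); [exact Hw|].
apply (ex_derive_continuous (fun x => quintic_x x 0)).
unfold quintic_x. auto_derive; exact I.
Qed.

Lemma continuous_exp_RInt (w : R -> R) (e x : R) :
  (forall u, continuous w u) -> continuous (fun x => exp (RInt w x e)) x.
Proof.
intros Hw. apply (continuous_comp (fun x => RInt w x e) exp).
- apply (ex_derive_continuous (fun x => RInt w x e)). eexists.
  apply (is_derive_RInt' w (fun x => RInt w x e) x e); [|apply Hw].
  apply filter_forall. intros y. apply (RInt_correct (V := R_CompleteNormedModule)).
  apply (ex_RInt_continuous (V := R_CompleteNormedModule)). auto.
- apply (ex_derive_continuous exp). eexists. apply is_derive_exp.
Qed.

Lemma continuous_weight_exp v w e x :
  (forall u, continuous v u) -> (forall u, continuous w u) ->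
  continuous (fun x => v x * quintic_x x 0 *
                       exp (RInt (fun u => w u * quintic_x u 0) x e)) x.
Proof.
intros Hv Hw.
apply (continuous_mult (fun x => v x * quintic_x x 0)
  (fun x => exp (RInt (fun u => w u * quintic_x u 0) x e))).
- apply continuous_weight, Hv.
- apply continuous_exp_RInt. intros; apply continuous_weight, Hw.
Qed.

Lemma model_parametrizes k h Gamma j a b c e sigma :
  localized k -> localized h ->
  (forall x, continuous k x) -> (forall x, continuous h x) ->
  traversal a b c e sigma -> follows k h Gamma j a b ->
  (forall x, a < x < b -> drift x = sigma) ->
  (forall x, a < x < b -> 0 < quintic_x x 0) ->
  parametrizes (model k h) (of_x k) (of_x h)
    (on_part (model k h) model_geometry Gamma j) (plane_curve c e).
Proof.
intros Hk Hh Ck Ch [Hab Hce] [HG1 HG2] Hdr Hpos.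
assert (Em : Rmin c e = a /\ Rmax c e = b).
{ destruct Hce as [[-> [-> _]]|[-> [-> _]]];
  [rewrite Rmin_left, Rmax_right|rewrite Rmin_right, Rmax_left]; lra. }
destruct Em as [Em EM].
unfold parametrizes; simpl c_start; simpl c_end; simpl c_z. rewrite Em, EM.
split; [|split; [|split; [|split]]].
- destruct Hce as [[-> [-> _]]|[-> [-> _]]]; lra.
- intros x y z H. pose proof H as [_ [HC _]]. apply model_critical in HC.
  destruct HC as [_ Ey]. destruct (HG1 x y z H) as [Hx Hz].
  split; [exact Hx|]. split; [exact Hz|]. subst z. exact Ey.
- intros x Hx. split; [now apply HG2|].
  rewrite model_reduced_xdot by (simpl; ring). rewrite (Hdr x Hx).
  pose proof (Rinv_0_lt_compat _ (Hpos x Hx)) as Hi. unfold Rdiv.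
  destruct Hce as [[-> [-> ->]]|[-> [-> ->]]]; nra.
- rewrite (model_p_int k h h c e Hh).
  apply (ex_RInt_continuous (V := R_CompleteNormedModule)).
  intros; apply continuous_weight, Ch.
- rewrite (model_qexp_int k h c e Hk Hh).
  apply (ex_RInt_continuous (V := R_CompleteNormedModule)).
  intros; now apply continuous_weight_exp.
Qed.

(** Neither G nor H acts on the right-hand sheet. *)
Lemma M_curve_inactive k h r Z : localized k -> localized h -> 1 < r ->
  M_curve (model k h) (of_x k) (of_x h) (plane_curve r 1) Z = Z.
Proof.
intros Hk Hh Hr. unfold M_curve. rewrite model_p_int, model_qexp_int by auto.
simpl c_start; simpl c_end.
assert (In : forall x, Rmin r 1 < x < Rmax r 1 -> inactive x).
{ intros x Hx. rewrite Rmin_right, Rmax_left in Hx by lra. unfold inactive; lra. }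
assert (Zero : forall v : R -> R,
  (forall x, inactive x -> v x = 0) -> RInt v r 1 = 0).
{ intros v Hv. rewrite (RInt_ext v (fun _ => 0)) by auto.
  rewrite RInt_const. unfold scal; simpl; unfold mult; simpl. ring. }
rewrite !Zero.
- rewrite exp_0. ring.
- intros x Hx. rewrite Hk by exact Hx. ring.
- intros x Hx. rewrite Hh by exact Hx. ring.
Qed.

(** A nonnegative weight that does not vanish identically on the segment
    realizes every affine map with positive slope: its amplitude in H tunes the slope through the exponential,
    after which its amplitude in G tunes the constant linearly. *)
Lemma affine_map_realized w c e u v A B :
  c <= u -> u < v -> v <= e -> (forall x, continuous w x) ->
  (forall x, 0 <= w x) -> (forall x, u < x < v -> 0 < w x) ->
  (forall x, c < x < e -> 0 < quintic_x x 0) -> 0 < A ->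
  exists kappa alpha, forall k h, localized k -> localized h ->
    (forall x, c < x < e -> k x = kappa * w x /\ h x = alpha * w x) ->
    forall Z, M_curve (model k h) (of_x k) (of_x h) (plane_curve c e) Z = A * Z + B.
Proof.
intros Hcu Huv Hve Cw W0 W1 Hq HA.
set (wq := fun x => w x * quintic_x x 0).
assert (Cq : forall x, continuous wq x) by (intros; apply continuous_weight, Cw).
assert (I0 : 0 < RInt wq c e).
{ apply RInt_pos_of_pos_on_subinterval with u v; auto.
  - intros x Hx. apply Rmult_le_pos; [apply W0|left; now apply Hq].
  - intros x Hx. apply Rmult_lt_0_compat; [now apply W1|apply Hq; lra]. }
set (alpha := ln A / RInt wq c e).
assert (RS : forall x, RInt (fun u => alpha * wq u) x e = alpha * RInt wq x e).
{ intros x. apply (RInt_scal (V := R_CompleteNormedModule) wq x e alpha).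
  apply (ex_RInt_continuous (V := R_CompleteNormedModule)); auto. }
assert (CE : forall x, continuous (fun x => exp (RInt (fun u => alpha * wq u) x e)) x).
{ intros x. apply continuous_exp_RInt. intros y.
  apply (continuous_mult (fun _ => alpha) wq); [apply continuous_const|apply Cq]. }
set (we := fun x => wq x * exp (RInt (fun u => alpha * wq u) x e)).
assert (Ce : forall x, continuous we x).
{ intros x. apply (continuous_mult wq); auto. }
assert (J0 : 0 < RInt we c e).
{ apply RInt_pos_of_pos_on_subinterval with u v; auto.
  - intros x Hx. apply Rmult_le_pos; [|left; apply exp_pos].
    apply Rmult_le_pos; [apply W0|left; now apply Hq].
  - intros x Hx. apply Rmult_lt_0_compat; [|apply exp_pos].
    apply Rmult_lt_0_compat; [now apply W1|apply Hq; lra]. }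
(* The weight of kappa depends on alpha, so alpha is chosen before kappa. *)
exists (B / RInt we c e), alpha. intros k h Hk Hh Hkh Z.
assert (Ep : forall x, c <= x <= e ->
  RInt (fun u => h u * quintic_x u 0) x e = RInt (fun u => alpha * wq u) x e).
{ intros x Hx. apply RInt_ext. intros y Hy. rewrite Rmin_left, Rmax_right in Hy by lra.
  destruct (Hkh y) as [_ ->]; [lra|]. unfold wq; simpl. ring. }
unfold M_curve. rewrite model_p_int, model_qexp_int by auto.
simpl c_start; simpl c_end. rewrite (Ep c) by lra. rewrite RS.
assert (Ea : alpha * RInt wq c e = ln A) by (unfold alpha; field; lra).
rewrite Ea, exp_ln by exact HA. f_equal.
rewrite (RInt_ext _ (fun x => B / RInt we c e * we x) c e).
- assert (EJ : B / RInt we c e * RInt we c e = B) by (field; lra).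
  apply eq_trans with (2 := EJ).
  apply (RInt_scal (V := R_CompleteNormedModule) we c e (B / RInt we c e)).
  apply (ex_RInt_continuous (V := R_CompleteNormedModule)); auto.
- intros x Hx. rewrite Rmin_left, Rmax_right in Hx by lra.
  rewrite Ep by lra. destruct (Hkh x) as [-> _]; [lra|]. unfold we, wq; simpl. ring.
Qed.

Theorem theorem3p3 (a11 a12 a21 a22 : R) (M : R -> R)
    (ha11 : 0 < a11) (ha21 : 0 < a21)
    (hMneg : forall Z, Z < 0 -> M Z = a11 * Z + a12)
    (hMpos : forall Z, 0 < Z -> M Z = a21 * Z + a22) :
  exists (s : slow_fast) (G : geometry) (Gf Hf : R -> R -> R -> R -> R -> R)
         (GammaL GammaS : region),
    smooth_system s /\
    assumption1 s G /\
    assumption2 s G /\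
    assumption3 s G /\
    section_ok s G /\
    assumption4 s G /\
    assumption5 s G GammaL GammaS /\
    standing_convention s G Gf Hf GammaL GammaS /\
    associated_PAM s G Gf Hf GammaL GammaS M.
Proof.
destruct (affine_map_realized (bump (- (9 / 4)) (- (17 / 8))) (- (19 / 8)) (-2)
  (- (9 / 4)) (- (17 / 8)) a11 a12) as [k1 [h1 R1]]; try lra.
{ apply continuous_bump. } { apply bump_nonneg. } { apply bump_inside. }
{ intros; apply quintic_x_pos1; [apply small_z_0|lra]. }
destruct (affine_map_realized (bump (- (1 / 2)) (- (1 / 4))) (-1) (1 / 10 + 0)
  (- (1 / 2)) (- (1 / 4)) a21 a22) as [k2 [h2 R2]]; try lra.
{ apply continuous_bump. } { apply bump_nonneg. } { apply bump_inside. }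
{ intros; apply quintic_x_pos2; [apply small_z_0|lra]. }
pose proof (twist_localized k1 k2) as Lk. pose proof (twist_localized h1 h2) as Lh.
pose proof (continuous_twist k1 k2) as Ck. pose proof (continuous_twist h1 h2) as Ch.
assert (T1 : forall c1 c2 x, - (19 / 8) < x < -2 ->
  twist c1 c2 x = c1 * bump (- (9 / 4)) (- (17 / 8)) x).
{ intros c1 c2 x Hx. unfold twist. rewrite (bump_outside (- (1 / 2))) by lra. ring. }
assert (T2 : forall c1 c2 x, -1 < x < 1 / 10 + 0 ->
  twist c1 c2 x = c2 * bump (- (1 / 2)) (- (1 / 4)) x).
{ intros c1 c2 x Hx. unfold twist. rewrite (bump_outside (- (9 / 4))) by lra. ring. }
set (k := twist k1 k2) in *. set (h := twist h1 h2) in *.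
destruct (model_GammaL k h) as [GL [rL [HrL [GL1 [GL2 [GL3 [GL4 GL5]]]]]]].
destruct (model_GammaS k h) as [GS [rS [HrS [GS1 [GS2 [GS3 [GS4 GS5]]]]]]].
assert (Right : forall Gamma r, 1 < r -> follows k h Gamma Sa3 1 r ->
  parametrizes (model k h) (of_x k) (of_x h)
    (on_part (model k h) model_geometry Gamma Sa3) (plane_curve r 1)).
{ intros Gamma r Hr HG.
  apply model_parametrizes with (a := 1) (b := r) (sigma := -1); auto.
  - split; [lra|auto].
  - intros; apply drift_right; lra.
  - intros; apply quintic_x_pos3; [apply small_z_0|lra]. }
exists (model k h), model_geometry, (of_x k), (of_x h), GL, GS.
split; [apply model_smooth|]. split; [apply model_assumption1|].
split; [now apply model_assumption2|]. split; [now apply model_assumption3|].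
split; [apply model_section|]. split; [apply model_assumption4|].
split; [split; [exact GL1|split; [exact GS1|split; [exact GL2|exact GS2]]]|]. split.
- split; [apply smooth5_twist|]. split; [apply smooth5_twist|].
  split; [exact GL3|]. split; [exact GS3|].
  intros. unfold of_x; simpl. ring.
- exists (plane_curve (- (19 / 8)) (-2)), (plane_curve rL 1),
    (plane_curve (-1) (1 / 10 + 0)), (plane_curve rS 1).
  split; [|split; [|split; [|split; [|split]]]].
  + apply model_parametrizes with (a := - (19 / 8)) (b := -2) (sigma := 1); auto.
    * split; [lra|auto].
    * intros; apply drift_left; lra.
    * intros; apply quintic_x_pos1; [apply small_z_0|lra].
  + now apply Right.
  + apply model_parametrizes with (a := -1) (b := 1 / 10 + 0) (sigma := 1); auto.
    * split; [lra|auto].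
    * intros; apply drift_left; lra.
    * intros; apply quintic_x_pos2; [apply small_z_0|lra].
  + now apply Right.
  + intros Z HZ. rewrite M_curve_inactive, R1 by (auto; intros; split; now apply T1). now apply hMneg.
  + intros Z HZ. rewrite M_curve_inactive, R2 by (auto; intros; split; now apply T2). now apply hMpos.
Qed.
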